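(* Let $(X,d,\mu)$ be a metric measure space with uniformly locally doubling measure $\mu$. Let $E\subset X$ be closed, and let $\nu$ be a locally finite Borel regular measure on $X$ with $\operatorname{supp}\nu\subset E$. Let $p\in[1,\infty)$ and $\theta\in(0,p)$, and assume that $\nu$ is upper codimension-$\theta$ regular, that is, there exists a constant $C>0$ such that $$\nu(B_r(x)\cap E)\le C\,\frac{\mu(B_r(x))}{r^\theta}\qquad\text{for all }(x,r)\in E\times(0,1].$$ Then every $f\in B^{\theta/p}_{p,1}(X)$ has a trace $\operatorname{Tr}f$ to $E$, one has $\operatorname{Tr}f\in L_p(E,\nu)$, and the trace operator $\operatorname{Tr}:B^{\theta/p}_{p,1}(X)\to L_p(E,\nu)$ is bounded. Moreover, for each $f\in B^{\theta/p}_{p,1}(X)$, $$\lim_{r\to0}\frac{1}{\mu(B_r(x))}\int_{B_r(x)}|f(y)-\operatorname{Tr}f(x)|^p\,d\mu(y)=0$$ for $\nu$-almost every $x\in E$.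
   Context: A metric measure space $(X,d,\mu)$ consists of a complete separable metric space $(X,d)$ and a Borel regular (outer) measure $\mu$ with $0<\mu(B_r(x))<\infty$ for all $x\in X$, $r>0$, where $B_r(x)$ is the open ball. A measure is locally finite if it is finite on all balls. The measure $\mu$ is uniformly locally doubling if for every $R>0$ there is $C_\mu(R)>0$ with $\mu(B_{2r}(x))\le C_\mu(R)\mu(B_r(x))$ for all $x\in X$, $r\in(0,R]$. $L_1^{\mathrm{loc}}(X)$ is the space of ($\mu$-classes of) measurable functions integrable on every ball. For $f\in L_1^{\mathrm{loc}}(X)$ and $t>0$, put $$\overline\Delta_tf(x)=\frac1{\mu(B_t(x))}\int_{B_t(x)}\Big|f(y)-\frac1{\mu(B_t(x))}\int_{B_t(x)}f\,d\mu\Big|\,d\mu(y).$$ For $s\in(0,1)$, the Besov space $B^s_{p,1}(X)$ consists of all $f\in L_p(X)=L_p(X,\mu)$ with $\|f\|_{b^s_{p,1}(X)}:=\int_0^1 t^{-s}\|\overline\Delta_tf\|_{L_p(X)}\frac{dt}{t}<\infty$, with norm $\|f\|_{B^s_{p,1}(X)}=\|f\|_{L_p(X)}+\|f\|_{b^s_{p,1}(X)}$. Given $f\in L_1^{\mathrm{loc}}(X)$, a $\nu$-measurable function $\phi:E\to\mathbb R$ is called a trace of $f$ to $E$ if $\lim_{r\to0}\frac1{\mu(B_r(x))}\int_{B_r(x)}|f(y)-\phi(x)|\,d\mu(y)=0$ for $\nu$-a.e. $x\in E$; its class modulo $\nu$-negligible sets is denoted $\operatorname{Tr}f$. *)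

(* Defs.v *)
From HB Require Import structures.
From mathcomp Require Import all_boot all_order all_algebra.
From mathcomp Require Import all_classical all_reals all_analysis.

Set Implicit Arguments.
Unset Strict Implicit.
Unset Printing Implicit Defensive.

Import Order.TTheory GRing.Theory Num.Theory.
Import numFieldNormedType.Exports.

Local Open Scope classical_set_scope.
Local Open Scope ring_scope.
Local Open Scope ereal_scope.

(* The library's complete spaces are pointed, hence so are these: X is
   nonempty. *)
#[short(type="completeMetricType")]
HB.structure Definition CompleteMetric (K : numDomainType) :=
  {T of CompletePseudoMetric K T & PseudoMetric_isMetric K T}.

Section metric_measure_space.
Context {R : realType} {X : completeMetricType R}.
Implicit Types (mu nu : {outer_measure set X -> \bar R}) (E : set X).

Definition separable_space (T : topologicalType) : Prop :=
  exists D : set T, countable D /\ dense D.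

Definition borel_set (A : set X) : Prop := <<s @open X >> A.

Definition borel_regular mu : Prop :=
  (forall B, borel_set B -> mu.-caratheodory B) /\
  (forall A, exists B, [/\ borel_set B, A `<=` B & mu B = mu A]).

Definition metric_measure_space mu : Prop :=
  [/\ separable_space X, borel_regular mu &
      forall (x : X) (r : R), (0 < r)%R -> 0 < mu (ball x r) < +oo].

Definition locally_finite_on_balls mu : Prop :=
  forall (x : X) (r : R), (0 < r)%R -> mu (ball x r) < +oo.

Definition uniformly_locally_doubling mu : Prop :=
  forall r0 : R, (0 < r0)%R -> exists2 C : R, (0 < C)%R &
    forall (x : X) (r : R), (0 < r <= r0)%R ->
      mu (ball x (2 * r)%R) <= C%:E * mu (ball x r).

Definition measure_support mu : set X :=
  [set x | forall r : R, (0 < r)%R -> 0 < mu (ball x r)].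

Definition upper_codim_regular mu nu E (theta : R) : Prop :=
  exists2 C : R, (0 < C)%R &
    forall (x : X) (r : R), E x -> (0 < r <= 1)%R ->
      nu (ball x r `&` E) <= C%:E * (mu (ball x r) * ((r `^ theta)^-1)%:E).

(* The measure that mu induces on its Caratheodory sigma-algebra;
   "mu-measurable" and integrals refer to it throughout. *)
Definition cmeasure mu : {measure set (caratheodory_type mu) -> \bar R} := mu.

Definition average mu (A : set X) (g : X -> \bar R) : \bar R :=
  (mu A)^-1 * \int[cmeasure mu]_(y in A) g y.

Definition L1loc mu : set (X -> R) :=
  [set f | measurable_fun [set: caratheodory_type mu] f /\
     forall (x : X) (r : R), (0 < r)%R ->
       (cmeasure mu).-integrable (ball x r) (EFin \o f)].

Definition Lp_norm mu (p : R) (f : X -> R) : \bar R :=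
  'N[cmeasure mu]_p%:E[EFin \o f].

Definition in_Lp mu (p : R) (f : X -> R) : Prop := f \in Lfun (cmeasure mu) p%:E.

Definition mean_oscillation mu (t : R) (f : X -> R) (x : X) : \bar R :=
  let B := ball x t in
  average mu B (fun y => `| (f y)%:E - average mu B (EFin \o f) |).

Definition besov_seminorm mu (s p : R) (f : X -> R) : \bar R :=
  \int[lebesgue_measure]_(t in `]0%R, 1%R[)
    ((t `^ (- s))%:E * 'N[cmeasure mu]_p%:E[mean_oscillation mu t f] * (t^-1)%:E).

Definition besov mu (s p : R) : set (X -> R) :=
  [set f | in_Lp mu p f /\ besov_seminorm mu s p f < +oo].

Definition besov_norm mu (s p : R) (f : X -> R) : \bar R :=
  Lp_norm mu p f + besov_seminorm mu s p f.

(* Functions on E are represented by functions on X whose values off E are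
   irrelevant. *)
Definition is_trace mu nu E (f phi : X -> R) : Prop :=
  [/\ L1loc mu f,
      measurable_fun (E : set (caratheodory_type nu)) phi &
      {ae cmeasure nu, forall x : X, E x ->
        average mu (ball x r) (fun y => (`|f y - phi x|%R)%:E) @[r --> 0^'+]
          --> 0%E}].

Definition in_Lp_on nu E (p : R) (phi : X -> R) : Prop := in_Lp nu p (phi \_ E).

Definition Lp_norm_on nu E (p : R) (phi : X -> R) : \bar R :=
  Lp_norm nu p (phi \_ E).

(* T f phi reads "phi represents the image of the class of f". *)
Definition bounded_operator_to_Lp mu nu E (p : R) (V : set (X -> R))
    (normV : (X -> R) -> \bar R) (T : (X -> R) -> (X -> R) -> Prop) : Prop :=
  [/\ (forall f, V f -> exists phi, T f phi),
      (forall f phi, V f -> T f phi -> in_Lp_on nu E p phi),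
      (forall f g phi psi, V f -> V g -> f = g %[ae cmeasure mu] ->
         T f phi -> T g psi ->
         {ae cmeasure nu, forall x, E x -> phi x = psi x}),
      (forall (a : R) f g phi psi, V f -> V g -> T f phi -> T g psi ->
         T (fun x => a * f x + g x)%R (fun x => a * phi x + psi x)%R) &
      exists2 C : R, (0 <= C)%R &
        forall f phi, V f -> T f phi -> Lp_norm_on nu E p phi <= C%:E * normV f].

End metric_measure_space.

(* Main.v *)
Require Import Defs.
From mathcomp Require Import all_boot all_order all_algebra.
From mathcomp Require Import all_classical all_reals all_analysis.
From mathcomp Require Import measurable_realfun.
From mathcomp Require Import ring lra.
Import Order.TTheory GRing.Theory Num.Theory.
Import numFieldNormedType.Exports.
Local Open Scope classical_set_scope.
Local Open Scope ring_scope.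
Set Implicit Arguments.
Unset Strict Implicit.
Unset Printing Implicit Defensive.

(** The trace is the nu-almost everywhere limit of step functions S_j built
from the means of f at the dyadic scales r_j = 2^-(j+4), and everything is
controlled by one sequence of numbers, the p-energies of the oscillation of f at
these scales.

Discretisation. At scale j an r_j-separated net (z_{j,i})_i splits X into
Borel cells, each within 2 r_j of its centre, while the cores B(z_{j,i}, r_j / 2)
are disjoint. Let c_{j,i} and a_{j,i} be the mean and the mean oscillation of f on
B(z_{j,i}, 8 r_j), let S_j and G_j be the step functions with these values on the
cells, and put alpha_j ^ p = sum_i a_{j,i} ^ p mu(core_{j,i}). By doubling,
|S_{j+1} - S_j| <= K G_j [dist_cell_meanS]. If y lies in a core and
12 r_j <= t <= 16 r_j, then a_{j,i} is at most 2 K times the oscillation of f on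
B(y, t); integrating in y and t gives
sum_j 2 ^ (j theta / p) alpha_j <= 8 K |f|_b, where |f|_b is the Besov seminorm
[dev_energy_le_oscillation, sum_energy_root_le].

Passing to nu. Upper codimension theta and doubling give
nu(cell_{j,i} `&` E) <= kappa 2 ^ (j theta) mu(core_{j,i}) [codim_cells], so the
norm of G_j in L_p(E, nu) is at most kappa ^ (1/p) 2 ^ (j theta / p) alpha_j. By
Minkowski's inequality sum_j G_j lies in L_p(E, nu), hence S_j converges
nu-a.e. on E to some phi. The bound for phi follows from
|phi| <= |m| + K G_0 + K sum_j G_j, where m is the mean of f on the core at scale
0 and its L_p(E, nu) norm is bounded by the L_p norm of f because the cores are
disjoint [integral_trace_le].

Lebesgue points. The same energies show that S_j tends to f mu-a.e.
[ae_cell_mean_cvg], so |f - S_{j+1}| <= K sum_{k > j} G_k mu-a.e. The nu-integral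
over E of the averages over 3 r_j-balls of the p-th power of this tail is, by the
codimension bound and bounded overlap, at most a constant times
(2 ^ (j theta / p) sum_{k > j} alpha_k) ^ p, which is summable in j since
theta > 0 [sum_weighted_tail_powR_le]. The averages thus tend to 0 nu-a.e.
[ae_tail_average_cvg0]. For r_{j+1} < rho <= r_j the average of |f - phi(x)| ^ p over
B(x, rho) is bounded by that tail average, by G_j(x) ^ p and by
|S_j(x) - phi(x)| ^ p [average_powR_le], whence the limit asserted at p-th power
[ae_Lebesgue_powR]. It implies the one at power 1, so phi is a trace.

Finally a trace is unique nu-a.e. and is determined by the mu-class of f
[trace_ae_unique], which carries the bounds from phi to every trace. *)

(** * Real inequalities *)

Section real_inequalities.
Context {R : realType}.
Implicit Types (a b c l p x y : R).

Lemma ge0_ler_powR_le p x y : 0 <= p -> 0 <= x -> x <= y -> x `^ p <= y `^ p.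
Proof.
move=> p0 x0 xy; apply: ge0_ler_powR => //; rewrite nnegrE //.
exact: le_trans xy.
Qed.

(** If [l < a] then [a = a `^ (1 - p) * a `^ p] and the first factor decreases in
[a]. With a well chosen [l] this does the work of Jensen's and Hoelder's
inequalities. *)
Lemma le_threshold_powR p l a : 1 <= p -> 0 < l -> 0 <= a ->
  a <= l + l `^ (1 - p) * a `^ p.
Proof.
move=> p1 l0 a0; have [al|la] := leP a l.
  by rewrite (le_trans al)// lerDl mulr_ge0// powR_ge0.
have agt0 : 0 < a by exact: lt_trans la.
have aE : a = a `^ (1 - p) * a `^ p.
  by rewrite -powRD; [rewrite subrK powRr1|rewrite (gt_eqF agt0) implybT].
rewrite [leLHS]aE; apply: ler_wpDl; first exact: ltW.
rewrite ler_wpM2r ?powR_ge0//.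
rewrite -(opprB p 1) !powRN lef_pV2 ?posrE ?powR_gt0//.
by apply: ge0_ler_powR_le; [lra|exact: ltW|exact: ltW].
Qed.

Lemma powR_sum3_le p a b c : 0 <= p -> 0 <= a -> 0 <= b -> 0 <= c ->
  (a + b + c) `^ p <= 3 `^ p * (a `^ p + b `^ p + c `^ p).
Proof.
move=> p0 a0 b0 c0.
have key m : 0 <= m -> a <= m -> b <= m -> c <= m ->
    m `^ p <= a `^ p + b `^ p + c `^ p ->
    (a + b + c) `^ p <= 3 `^ p * (a `^ p + b `^ p + c `^ p).
  move=> m0 am bm cm mle.
  apply: (@le_trans _ _ ((3 * m) `^ p)).
    by apply: ge0_ler_powR_le => //; [rewrite !addr_ge0|lra].
  by rewrite powRM// ler_wpM2l ?powR_ge0.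
have [ha hb hc] := And3 (powR_ge0 a p) (powR_ge0 b p) (powR_ge0 c p).
have [ab|/ltW ba] := leP a b; have [bc|/ltW cb] := leP b c.
- by apply: (key c) => //; lra.
- by apply: (key b) => //; lra.
- have [ac|/ltW ca] := leP a c; first by apply: (key c) => //; lra.
  by apply: (key a) => //; lra.
- by apply: (key a) => //; lra.
Qed.

Lemma powRK p x : p != 0 -> 0 <= x -> (x `^ p) `^ p^-1 = x.
Proof. by move=> p0 x0; rewrite -powRrM mulfV// powRr1. Qed.

Lemma powRVK p x : p != 0 -> 0 <= x -> (x `^ p^-1) `^ p = x.
Proof. by move=> p0 x0; rewrite -powRrM mulVf// powRr1. Qed.

Lemma ler_powR_cancel p x y : 0 < p -> 0 <= x -> 0 <= y ->
  x `^ p <= y `^ p -> x <= y.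
Proof.
move=> p0 x0 y0 xy; have pn0 : p != 0 by rewrite gt_eqF.
rewrite -(powRK pn0 x0) -(powRK pn0 y0).
by apply: ge0_ler_powR_le => //; rewrite ?powR_ge0 ?invr_ge0 ?ltW.
Qed.

Lemma le_poweR p (x y : \bar R) : 0 <= p -> (0 <= x)%E -> (x <= y)%E ->
  (x `^ p <= y `^ p)%E.
Proof.
move=> p0 x0 xy; apply: gt0_ler_poweR => //; rewrite in_itv/= leey andbT//.
exact: le_trans xy.
Qed.

End real_inequalities.

(** * Integrals of step functions *)

Lemma measurable_fun_fibers d d' (T : measurableType d) (U : measurableType d')
    (idx : T -> nat) (a : nat -> U) D :
  (forall i, measurable (idx @^-1` [set i])) ->
  measurable_fun D (fun x => a (idx x)).
Proof.
move=> midx mD Y mY; apply: measurableI => //.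
have -> : (fun x => a (idx x)) @^-1` Y = \bigcup_(i in a @^-1` Y) idx @^-1` [set i].
  by apply/seteqP; split=> [x Yx|x /= [i Yi xi]] /=; [exists (idx x)|rewrite xi].
exact: bigcup_measurable.
Qed.

Section integral_lemmas.
Context d (T : measurableType d) (R : realType).
Variable mu : {measure set T -> \bar R}.
Implicit Types (D : set T).
Local Open Scope ereal_scope.

(** The integral of a nonnegative function is a supremum over the simple
functions below it, hence monotone on arbitrary functions. Thus a step function
bounds from below the integrals of the Lp norms of [mean_oscillation mu t f] over
[t] and of [osc (ball y t)] over [y]. *)
Lemma ge0_le_integral_lower D (f g : T -> \bar R) :
  (forall x, D x -> 0 <= f x) -> (forall x, D x -> f x <= g x) ->
  \int[mu]_(x in D) f x <= \int[mu]_(x in D) g x.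
Proof.
move=> f0 fg.
have g0 x : D x -> 0 <= g x by move=> Dx; exact: le_trans (f0 _ Dx) (fg _ Dx).
rewrite !ge0_integralE//.
apply: le_ereal_sup => _ [h hf <-]; exists h => //= x; apply: (le_trans (hf x)); rewrite !patchE.
by case: ifPn => //; rewrite inE => /fg.
Qed.

Lemma ae_in_lt_pinfty D (f : T -> \bar R) : measurable D -> measurable_fun D f ->
  (forall x, D x -> 0 <= f x) -> \int[mu]_(x in D) f x < +oo ->
  {ae mu, forall x, D x -> f x < +oo}.
Proof.
move=> mD mf f0 foo.
have fint : mu.-integrable D f.
  apply/integrableP; split => //.
  by under eq_integral => x /[1!inE] Dx do rewrite gee0_abs ?f0//.
have := integrable_ae mD fint.
apply: filterS => x /= + Dx => /(_ Dx).
by rewrite ge0_fin_numE// f0.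
Qed.

(** The sum of the series of functions has a finite integral, hence is finite
almost everywhere, and the terms of a convergent series tend to 0. *)
Lemma ae_cvg0_summable_integral D (f : (T -> \bar R)^nat) : measurable D ->
  (forall k, measurable_fun D (f k)) -> (forall k x, D x -> 0 <= f k x) ->
  \sum_(k <oo) \int[mu]_(x in D) f k x < +oo ->
  {ae mu, forall x, D x -> f k x @[k --> \oo] --> 0}.
Proof.
move=> mD mf f0; rewrite -integral_nneseries// => foo.
have := @ae_in_lt_pinfty D (fun x => \sum_(k <oo) f k x) mD.
case/(_ _ _ foo).
- by apply: ge0_emeasurable_sum => // k x Dx _; exact: f0.
- by move=> x Dx; apply: nneseries_ge0 => k _ _; exact: f0.
move=> N [mN N0 NP]; exists N; split => // x /= xP; apply: NP => /=.
apply: contra_not xP => xP Dx; move: (xP Dx) => /nneseries_tail_cvg tl0.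
have {}tl0 := tl0 (fun k _ => f0 k x Dx).
apply: (squeeze_cvge _ (cvg_cst 0) tl0).
apply: nearW => k; rewrite f0//= (nneseries_split k 1)//; last first.
  by move=> l _; exact: f0.
rewrite addn1 big_nat1 leeDl// nneseries_ge0// => l _ _; exact: f0.
Qed.

Lemma integral_fibers D (idx : T -> nat) (a : nat -> \bar R) : measurable D ->
  (forall i, measurable (idx @^-1` [set i])) -> (forall i, 0 <= a i) ->
  \int[mu]_(x in D) a (idx x) =
  \sum_(i <oo) a i * mu (idx @^-1` [set i] `&` D).
Proof.
move=> mD midx a0.
have -> : \int[mu]_(x in D) a (idx x) =
   \int[mu]_(x in \bigcup_i (idx @^-1` [set i] `&` D)) a (idx x).
  by congr integral; rewrite -setI_bigcupl; apply/seteqP; split => x //=;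
     [move=> Dx; split => //; exists (idx x)|case].
rewrite ge0_integral_bigcup//.
- apply: eq_eseriesr => i _.
  rewrite -integral_cst; last exact: measurableI.
  by apply: eq_integral => x; rewrite inE /= => -[->].
- by move=> k; exact: measurableI.
- exact: measurable_fun_fibers.
- apply/trivIsetP => i j _ _ /eqP ij; rewrite -subset0 => x [[/= xi _] [/= xj _]].
  by apply: ij; rewrite -xi.
Qed.

Lemma integral_nneseries_indic D (A : (set T)^nat) (c : nat -> \bar R) :
  measurable D -> (forall i, measurable (A i)) -> (forall i, 0 <= c i) ->
  \int[mu]_(x in D) (\sum_(i <oo) c i * (\1_(A i) x)%:E) =
  \sum_(i <oo) c i * mu (A i `&` D).
Proof.
move=> mD mA c0.
have mind i : measurable_fun D (fun x => (\1_(A i) x)%:E : \bar R).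
  exact/measurable_EFinP/measurable_indic.
rewrite integral_nneseries//; last 2 first.
- by move=> i; exact: measurable_funeM.
- by move=> i x _; rewrite mule_ge0 ?lee_fin.
apply: eq_eseriesr => i _; rewrite ge0_integralZl//.
by rewrite integral_indic.
Qed.

End integral_lemmas.

Lemma nneseries_indic_disjoint_le {R : realType} {U : Type} (A : nat -> set U)
    (c : nat -> \bar R) (M : \bar R) (x : U) : trivIset setT A ->
  (forall i, 0 <= c i)%E -> (0 <= M)%E ->
  (forall i, A i x -> c i <= M)%E ->
  (\sum_(i <oo) c i * (\1_(A i) x)%:E <= M)%E.
Proof.
move=> tA c0 M0 cM; apply: lime_le.
  by apply: is_cvg_nneseries => i _ _; rewrite mule_ge0 ?lee_fin.
apply: nearW; elim=> [|n ih]; first by rewrite big_nil.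
rewrite big_nat_recr// /=; have [xn|xn] := pselect (A n x); last first.
  by rewrite [\1_(A n) x]indicE memNset// mule0 addr0.
rewrite big_nat big1.
  by rewrite add0r indicE mem_set// mule1 cM.
move=> i /= ni; rewrite indicE memNset ?mule0// => xi.
have /trivIsetP/(_ i n I I) := tA.
by rewrite ltn_eqF// => /(_ isT); apply/eqP/set0P; exists x.
Qed.

(** * Minkowski's inequality for series *)

(** The p-th power of the sum of the series, taken as a limit of powers of real
partial sums: a divergent series gives [+oo] while the [g k] stay real valued. *)
Definition powR_sum_lim {R : realType} {U : Type} (p : R) (g : nat -> U -> R) x :=
  limn (fun n => ((\sum_(k < n) g k x) `^ p)%:E).

Section minkowski_sums.
Context d (T : measurableType d) (R : realType).
Variable mu : {measure set T -> \bar R}.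
Variables (D : set T) (mD : measurable D) (p : R) (p1 : 1 <= p).
Variables (g : (T -> R)^nat) (w : R^nat).
Hypothesis mg : forall k, measurable_fun D (g k).
Hypothesis g0 : forall k x, D x -> 0 <= g k x.
Hypothesis w0 : forall k, 0 <= w k.
Hypothesis gw : forall k, (\int[mu]_(x in D) ((g k x) `^ p)%:E <= (w k `^ p)%:E)%E.

Let p0 : 0 < p. Proof. by rewrite (lt_le_trans _ p1). Qed.
Let pn0 : p != 0. Proof. by rewrite gt_eqF. Qed.

Let Lnorm_restrict (h : T -> R) : (forall x, D x -> 0 <= h x) ->
  (\int[mu]_(x in D) ((h x) `^ p)%:E)%E =
  ('N[mu]_p%:E[EFin \o (h \_ D)] `^ p)%E.
Proof.
move=> h0; rewrite (poweR_Lnorm mu _ pn0) integral_mkcond.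
apply: eq_integral => x _; rewrite /= !patchE.
case: ifPn => [/[1!inE] Dx|_]; first by rewrite ger0_norm// h0.
by rewrite normr0 powR0.
Qed.

Lemma minkowski_sum n :
  (\int[mu]_(x in D) ((\sum_(k < n) g k x) `^ p)%:E
     <= ((\sum_(k < n) w k) `^ p)%:E)%E.
Proof.
rewrite Lnorm_restrict; last by move=> x Dx; apply: sumr_ge0 => k _; exact: g0.
rewrite -poweR_EFin; apply: le_poweR; [exact: ltW|exact: Lnorm_ge0|].
elim: n => [|n ih].
  rewrite big_ord0 (_ : _ \o _ = cst 0%E) ?Lnorm0//.
  by apply/funext => x/=; rewrite patchE big_ord0; case: ifP.
rewrite big_ord_recr/= EFinD.
rewrite (_ : _ \_ D =
    ((fun x => \sum_(k < n) g k x) \_ D) \+ (g n \_ D))%R; last first.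
  apply/funext => x/=; rewrite !patchE.
  by case: ifP; rewrite ?addr0// big_ord_recr.
have msum : measurable_fun D (fun x => \sum_(k < n) g k x) by exact: measurable_sum.
apply: le_trans; first apply: minkowski_EFin => //.
- exact/(measurable_restrictT _ _).1.
- exact/(measurable_restrictT _ _).1.
apply: leeD => //.
have := gw n; rewrite Lnorm_restrict; last exact: g0.
move: (Lnorm_ge0 mu p%:E (EFin \o (g n \_ D))).
case: ('N[mu]_p%:E[_])%E => [y| |]//=.
- rewrite !lee_fin => y0; exact: ler_powR_cancel.
- by rewrite (negbTE pn0) leye_eq.
Qed.

Let powR_sum_nd x : D x -> {homo (fun n => ((\sum_(k < n) g k x) `^ p)%:E) :
  n m / (n <= m)%N >-> (n <= m)%E}.
Proof.
move=> Dx n m nm; rewrite lee_fin; apply: ge0_ler_powR_le; first exact: ltW.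
  by apply: sumr_ge0 => k _; exact: g0.
rewrite -!(big_mkord predT (fun k => g k x)).
by rewrite [leRHS](@big_cat_nat _ _ _ n)//= lerDl sumr_ge0// => k _; exact: g0.
Qed.

Lemma powR_sum_le_lim n x : D x ->
  (((\sum_(k < n) g k x) `^ p)%:E <= powR_sum_lim p g x)%E.
Proof.
move=> Dx; apply: lime_ge.
  by apply: ereal_nondecreasing_is_cvgn; exact: powR_sum_nd.
by near=> m; apply: powR_sum_nd => //; near: m; exact: nbhs_infty_ge.
Unshelve. all: by end_near.
Qed.

Lemma powR_sum_lim_ge0 x : D x -> (0 <= powR_sum_lim p g x)%E.
Proof.
by move=> Dx; apply: le_trans (powR_sum_le_lim 0 Dx); rewrite lee_fin powR_ge0.
Qed.

Let mpow n : measurable_fun D (fun x => ((\sum_(k < n) g k x) `^ p)%:E).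
Proof.
apply/measurable_EFinP; apply: (measurableT_comp (measurable_powR p)).
exact: measurable_sum.
Qed.

Lemma powR_sum_lim_lt_pinfty x : D x -> (powR_sum_lim p g x < +oo)%E ->
  exists M, forall n, \sum_(k < n) g k x <= M.
Proof.
move=> Dx; have := powR_sum_le_lim ^~ x; have := powR_sum_lim_ge0 Dx.
case: (powR_sum_lim p g x) => [y| |]// y0 yub _; exists (y `^ p^-1) => n.
have s0 : 0 <= \sum_(k < n) g k x by apply: sumr_ge0 => k _; exact: g0.
apply: (ler_powR_cancel p0 s0); first exact: powR_ge0.
by rewrite powRVK//; have := yub n Dx; rewrite lee_fin.
Qed.

(** Partial sums that control a sequence also control its limit. *)
Lemma powR_dist_lim_le (u : R^nat) l c x : D x ->
  (forall n, `|u n - c| <= \sum_(k < n) g k x) -> u n @[n --> \oo] --> l ->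
  ((`|l - c| `^ p)%:E <= powR_sum_lim p g x)%E.
Proof.
move=> Dx ug ul; have := powR_sum_le_lim ^~ x; have := powR_sum_lim_ge0 Dx.
case: (powR_sum_lim p g x) => [y| |] //; last by move=> _ _; rewrite leey.
rewrite lee_fin => y0 yub; rewrite -(powRVK pn0 y0).
apply: ge0_ler_powR_le; [exact: ltW|by []|].
have ulc : `|u n - c| @[n --> \oo] --> `|l - c|.
  by apply: cvg_norm; apply: cvgB => //; exact: cvg_cst.
apply: (@closed_cvg _ _ _ eventually_filter (fun n => `|u n - c|) [set z | z <= y `^ p^-1]) ulc.
  exact: closed_le.
apply: nearW => n /=; apply: (ler_powR_cancel p0); rewrite ?powR_ge0// powRVK//.
have := yub n Dx; rewrite lee_fin; apply: le_trans.
by apply: ge0_ler_powR_le; [exact: ltW|by []|exact: ug].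
Qed.

Lemma measurable_powR_sum_lim : measurable_fun D (powR_sum_lim p g).
Proof.
apply: (@emeasurable_fun_cvg _ _ _ _ (fun n x => ((\sum_(k < n) g k x) `^ p)%:E)) => //.
by move=> x Dx; apply: ereal_nondecreasing_is_cvgn; exact: powR_sum_nd.
Qed.

(** Monotone convergence applied to the finite case: the partial sums of the
[g k] are nonnegative and nondecreasing. *)
Lemma minkowski_series (W : R) : (forall n, \sum_(k < n) w k <= W) ->
  (\int[mu]_(x in D) powR_sum_lim p g x <= (W `^ p)%:E)%E.
Proof.
move=> wW; rewrite monotone_convergence//; last first.
  by move=> n x _; rewrite lee_fin powR_ge0.
apply: lime_le.
  apply: ereal_nondecreasing_is_cvgn => n m nm; apply: ge0_le_integral => //.
    by move=> x _; rewrite lee_fin powR_ge0.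
  by move=> x Dx; exact: powR_sum_nd.
apply: nearW => n; apply: (le_trans (minkowski_sum n)).
rewrite lee_fin; apply: ge0_ler_powR_le; [exact: ltW|exact: sumr_ge0|exact: wW].
Qed.

Lemma ae_bounded_sums (W : R) : (forall n, \sum_(k < n) w k <= W) ->
  {ae mu, forall x, D x -> exists M, forall n, \sum_(k < n) g k x <= M}.
Proof.
move=> wW.
have := ae_in_lt_pinfty mD measurable_powR_sum_lim powR_sum_lim_ge0
  (le_lt_trans (minkowski_series wW) (ltry _)).
by apply: filterS => x xY Dx; exact: powR_sum_lim_lt_pinfty (xY Dx).
Qed.

End minkowski_sums.

(** * Tails of geometrically weighted sequences *)

Section weighted_tails.
Context {R : realType}.
Variables (t M : R) (a : R^nat).
Hypothesis t1 : 1 < t.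
Hypothesis a0 : forall k, 0 <= a k.
Hypothesis aM : forall n, \sum_(k < n) t ^+ k * a k <= M.

Let tk_ge1 k : 1 <= t ^+ k. Proof. by rewrite exprn_ege1// ltW. Qed.

Let tail_cvg j : cvgn (fun n => \sum_(k < n) a (j + k)%N).
Proof.
apply: nondecreasing_is_cvgn.
  apply/nondecreasing_seqP => n; rewrite big_ord_recr/= lerDl; exact: a0.
exists M => _ [n _ <-]; apply: le_trans (aM (j + n)).
rewrite big_split_ord/=; apply: ler_wpDl.
  by apply: sumr_ge0 => k _; rewrite mulr_ge0// (le_trans _ (tk_ge1 _)).
by apply: ler_sum => k _; rewrite ler_peMl.
Qed.

Definition tail j := limn (fun n => \sum_(k < n) a (j + k)%N).

Lemma sum_le_tail j n : \sum_(k < n) a (j + k)%N <= tail j.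
Proof.
apply: nondecreasing_cvgn_le; last exact: tail_cvg.
apply/nondecreasing_seqP => m; rewrite big_ord_recr/= lerDl; exact: a0.
Qed.

Lemma tail_ge0 j : 0 <= tail j.
Proof. by have := sum_le_tail j 0; rewrite big_ord0. Qed.

Lemma tail_rec j : tail j = a j + tail j.+1.
Proof.
rewrite /tail; apply/cvg_lim => //; rewrite -(cvg_shiftS _).
under eq_fun do rewrite big_ord_recl addn0.
apply: cvgD; first exact: cvg_cst.
under eq_fun do under eq_bigr do rewrite lift0 addnS -addSn.
exact: tail_cvg.
Qed.

Lemma weighted_tail_le j : t ^+ j * tail j <= M.
Proof.
rewrite mulrC -ler_pdivlMr ?(lt_le_trans _ (tk_ge1 _))//.
apply: limr_le; first exact: tail_cvg.
apply: nearW => n; rewrite ler_pdivlMr ?(lt_le_trans _ (tk_ge1 _))// mulrC.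
apply: le_trans (aM (j + n)).
rewrite big_split_ord/= mulr_sumr; apply: ler_wpDl.
  by apply: sumr_ge0 => k _; rewrite mulr_ge0// (le_trans _ (tk_ge1 _)).
by apply: ler_sum => k _; rewrite ler_wpM2r// ler_weXn2l ?leq_addr// ltW.
Qed.

(** Multiplying [tail j = a j + tail j.+1] by [t ^+ j] and summing gives
[t * s <= s + 2 * M] for the sum [s] on the left, and [t > 1]. *)
Lemma sum_weighted_tail_le n :
  \sum_(j < n) t ^+ j * tail j.+1 <= 2 * M / (t - 1).
Proof.
rewrite ler_pdivlMr ?subr_gt0//.
suff : t * (\sum_(j < n) t ^+ j * tail j.+1) <=
    \sum_(j < n) t ^+ j * tail j.+1 + M + M by lra.
have -> : t * (\sum_(j < n) t ^+ j * tail j.+1) = \sum_(j < n) t ^+ j.+1 * tail j.+1.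
  by rewrite mulr_sumr; apply: eq_bigr => j _; rewrite exprS mulrA.
have -> : \sum_(j < n) t ^+ j.+1 * tail j.+1 =
    \sum_(j < n.+1) t ^+ j * tail j - tail 0.
  by rewrite [in RHS]big_ord_recl expr0 mul1r addrC addKr.
have -> : \sum_(j < n.+1) t ^+ j * tail j =
   \sum_(j < n) t ^+ j * tail j.+1 + \sum_(j < n) t ^+ j * a j + t ^+ n * tail n.
  rewrite big_ord_recr/= -big_split/=; congr (_ + _).
  by apply: eq_bigr => j _; rewrite tail_rec mulrDr addrC.
have := tail_ge0 0; have := weighted_tail_le n; have := aM n; lra.
Qed.

(** The terms are at most [M], so that all but one of the [p] factors can be
bounded by [M]. *)
Lemma sum_weighted_tail_powR_le p : 1 <= p ->
  exists M', forall n, \sum_(j < n) (t ^+ j * tail j.+1) `^ p <= M'.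
Proof.
move=> p1; exists (M `^ (p - 1) * (2 * M / (t - 1))) => n.
have M0 : 0 <= M by have := aM 0; rewrite big_ord0.
apply: (@le_trans _ _ (M `^ (p - 1) * \sum_(j < n) t ^+ j * tail j.+1)).
  rewrite mulr_sumr; apply: ler_sum => j _.
  have u0 : 0 <= t ^+ j * tail j.+1.
    by rewrite mulr_ge0 ?tail_ge0// (le_trans _ (tk_ge1 _)).
  rewrite -(@mulr_powRB1 _ _ p)//; last by rewrite (lt_le_trans _ p1).
  rewrite mulrC ler_wpM2r//; apply: ge0_ler_powR_le => //; first by lra.
  apply: le_trans (weighted_tail_le j); rewrite ler_wpM2l ?(le_trans _ (tk_ge1 _))//.
  by rewrite [leRHS]tail_rec lerDr.
by rewrite ler_wpM2l ?powR_ge0// sum_weighted_tail_le.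
Qed.

End weighted_tails.

(** * Averages, means and oscillations *)

Section averages.
Context {R : realType} {X : completeMetricType R}.
Variable mu : {outer_measure set X -> \bar R}.
Local Notation m := (cmeasure mu).
Local Notation T := (caratheodory_type mu).
Implicit Types (B : set X) (f : X -> R).
Local Open Scope ereal_scope.

Lemma average_ge0 B (g : X -> \bar R) : (forall y, B y -> 0 <= g y) ->
  0 <= average mu B g.
Proof.
by move=> g0; rewrite mule_ge0 ?inve_ge0 ?outer_measure_ge0// integral_ge0.
Qed.

Lemma le_average B (g h : X -> \bar R) : (forall y, B y -> 0 <= g y) ->
  (forall y, B y -> g y <= h y) -> average mu B g <= average mu B h.
Proof.
move=> g0 gh; rewrite lee_wpmul2l ?inve_ge0 ?outer_measure_ge0//.
exact: ge0_le_integral_lower.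
Qed.

Variable B : set X.
Hypothesis mB : measurable (B : set T).
Hypothesis B_gt0 : 0 < mu B.
Hypothesis B_fin : mu B < +oo.

Lemma averageE (g : X -> \bar R) :
  average mu B g = ((fine (mu B))^-1)%:E * \int[m]_(y in B) g y.
Proof.
rewrite /average -{1}(@fineK _ (mu B)); last by rewrite ge0_fin_numE// ltW.
by rewrite inver gt_eqF// fine_gt0// B_gt0 B_fin.
Qed.

Lemma measure_EFin : exists2 v, (0 < v)%R & mu B = v%:E.
Proof.
exists (fine (mu B)); first by rewrite fine_gt0// B_gt0 B_fin.
by rewrite fineK// ge0_fin_numE// ltW.
Qed.

Lemma mul_average (g : X -> \bar R) :
  mu B * average mu B g = \int[m]_(y in B) g y.
Proof.
have [v v0 vE] := measure_EFin.
by rewrite averageE vE/= muleA -EFinM divff ?gt_eqF// mul1e.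
Qed.

Lemma average_cst (c : \bar R) : average mu B (fun=> c) = c.
Proof.
have [v v0 vE] := measure_EFin.
rewrite averageE (_ : \int[m]_(_ in B) c = c * mu B); last exact: (integral_cst m mB).
by rewrite vE/= [c * _]muleC muleA -EFinM mulVf ?gt_eqF// mul1e.
Qed.

Lemma integrable_cst_fin (c : R) : m.-integrable (B : set T) (fun=> c%:E).
Proof.
apply/integrableP; split; first exact: measurable_cst.
rewrite (_ : \int[m]_(_ in B) _ = `|c%:E| * mu B); last exact: (integral_cst m mB).
by rewrite lte_mul_pinfty.
Qed.

Lemma averageD (g h : X -> \bar R) :
  (forall y, B y -> 0 <= g y) -> measurable_fun (B : set T) g ->
  (forall y, B y -> 0 <= h y) -> measurable_fun (B : set T) h ->
  average mu B (fun y => g y + h y) = average mu B g + average mu B h.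
Proof.
move=> g0 mg h0 mh; rewrite !averageE ge0_integralD//.
by rewrite ge0_muleDr// integral_ge0.
Qed.

Lemma averageZ (k : R) (g : X -> \bar R) : (0 <= k)%R ->
  (forall y, B y -> 0 <= g y) -> measurable_fun (B : set T) g ->
  average mu B (fun y => k%:E * g y) = k%:E * average mu B g.
Proof.
move=> k0 g0 mg; rewrite !averageE ge0_integralZl//.
by rewrite muleCA.
Qed.

Lemma average_le_subset A (K : R) (g : X -> \bar R) :
  measurable (A : set T) -> 0 < mu A ->
  A `<=` B -> mu B <= K%:E * mu A -> measurable_fun (B : set T) g ->
  (forall y, B y -> 0 <= g y) -> average mu A g <= K%:E * average mu B g.
Proof.
move=> mA A0 AB BKA mg g0.
have Afin : mu A < +oo by apply: le_lt_trans B_fin; exact: le_outer_measure.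
have [v v0 vE] := measure_EFin.
have [u u0 uE] : exists2 u, (0 < u)%R & mu A = u%:E.
  exists (fine (mu A)); first by rewrite fine_gt0// A0 Afin.
  by rewrite fineK// ge0_fin_numE// ltW.
rewrite averageE /average uE vE/= inver gt_eqF// muleA -EFinM.
apply: lee_pmul.
- by rewrite lee_fin invr_ge0 ltW.
- by apply: integral_ge0 => y /AB; exact: g0.
- rewrite lee_fin ler_pdivlMr// ler_pdivrMl//.
  by move: BKA; rewrite uE vE -EFinM lee_fin mulrC.
- exact: (@ge0_subset_integral _ _ _ m).
Qed.

Section integrable_function.
Variable f : X -> R.
Hypothesis intf : m.-integrable (B : set T) (EFin \o f).

Definition mean : R := fine (average mu B (EFin \o f)).

Let mf : measurable_fun (B : set T) f.
Proof. by have := measurable_int m intf => /measurable_EFinP. Qed.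

Lemma meanE : average mu B (EFin \o f) = mean%:E.
Proof.
rewrite /mean fineK// averageE fin_numM//.
exact: integrable_fin_num.
Qed.

Lemma measurable_dist (c : R) : measurable_fun (B : set T) (fun y => `|f y - c|%:E).
Proof.
apply/measurable_EFinP; apply: measurableT_comp => //.
exact: measurable_funB.
Qed.

Lemma dist_mean_le (c : R) :
  `|mean - c|%:E <= average mu B (fun y => `|f y - c|%:E).
Proof.
have intc := integrable_cst_fin c.
have mE : (mean - c)%:E = average mu B (fun y => (f y - c)%:E).
  rewrite EFinB -meanE -{1}(average_cst c%:E) !averageE.
  under [in RHS]eq_integral do rewrite EFinB.
  rewrite -muleBr//; last first.
    by rewrite fin_num_adde_defr// (integrable_fin_num mB intf).
  by rewrite -integralB.
rewrite -abse_EFin mE !averageE abseM gee0_abs ?lee_fin ?invr_ge0 ?fine_ge0//.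
rewrite lee_wpmul2l ?lee_fin ?invr_ge0 ?fine_ge0//.
apply: (@le_abse_integral _ _ _ m) => //.
by apply/measurable_EFinP; exact: measurable_funB.
Qed.

Lemma average_threshold (p l : R) : (1 <= p)%R -> (0 < l)%R ->
  average mu B (fun y => `|f y|%:E) <=
  l%:E + (l `^ (1 - p))%:E * average mu B (fun y => (`|f y| `^ p)%:E).
Proof.
move=> p1 l0.
have mfp : measurable_fun (B : set T) (fun y => (`|f y| `^ p)%:E).
  apply/measurable_EFinP; apply: (measurableT_comp (measurable_powR p)).
  exact: measurableT_comp.
rewrite -[in l%:E + _](average_cst l%:E) -averageZ ?powR_ge0//.
rewrite -averageD//.
- apply: le_average => y _; first by rewrite lee_fin.
  by rewrite -EFinM -EFinD lee_fin le_threshold_powR.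
- by move=> y _; rewrite lee_fin ltW.
- by move=> y _; rewrite -EFinM lee_fin mulr_ge0 ?powR_ge0.
- exact: measurable_funeM.
Qed.

(** The threshold [l] close to [M `^ p^-1], with [M] the average on the right,
replaces Jensen's inequality at the cost of the factor [2 `^ p]. *)
Lemma mean_powR_le (p : R) : (1 <= p)%R ->
  (`|mean| `^ p)%:E <= (2 `^ p)%:E * average mu B (fun y => (`|f y| `^ p)%:E).
Proof.
move=> p1; have p0 : (0 < p)%R by rewrite (lt_le_trans _ p1).
have pn0 : (p != 0)%R by rewrite gt_eqF.
have := average_threshold p1.
have : 0 <= average mu B (fun y => (`|f y| `^ p)%:E).
  by apply: average_ge0 => y _; rewrite lee_fin powR_ge0.
case: (average _ _ _) => [M| |]//; last first.
  by move=> _ _; rewrite gt0_muley ?leey// lte_fin powR_gt0.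
rewrite lee_fin => M0 thr.
have mthr l : (0 < l)%R -> (`|mean| <= l + l `^ (1 - p) * M)%R.
  move=> l0; have := le_trans (dist_mean_le 0%R) _.
  under [X in average mu B X]eq_fun do rewrite subr0.
  by rewrite subr0 => /(_ _ (thr l l0)); rewrite -EFinM -EFinD lee_fin.
rewrite -EFinM lee_fin -[M in leRHS](powRVK pn0 M0) -powRM ?powR_ge0//.
apply: ge0_ler_powR_le => //; first exact: ltW.
apply/ler_addgt0Pr => e e0.
(* The slack [e / 2] keeps the threshold positive when [M = 0]. *)
pose l := (M `^ p^-1 + e / 2)%R.
have l0 : (0 < l)%R by rewrite ltr_wpDl ?powR_ge0// divr_gt0.
apply: le_trans (mthr _ l0) _.
have : (l `^ (1 - p) * M <= l)%R.
  have lE : (l = l `^ (1 - p) * l `^ p)%R.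
    by rewrite -powRD; [rewrite subrK powRr1// ltW|rewrite (gt_eqF l0) implybT].
  rewrite [leRHS]lE ler_wpM2l ?powR_ge0// -[leLHS](powRVK pn0 M0).
  apply: ge0_ler_powR_le; [exact: ltW|exact: powR_ge0|].
  by rewrite /l lerDl divr_ge0// ltW.
rewrite /l; lra.
Qed.

End integrable_function.
End averages.

Section oscillation.
Context {R : realType} {X : completeMetricType R}.
Variable mu : {outer_measure set X -> \bar R}.
Local Notation m := (cmeasure mu).
Local Notation T := (caratheodory_type mu).
Implicit Types (A B : set X).
Variable f : X -> R.
Local Open Scope ereal_scope.

Definition osc B : R := fine (average mu B (fun y => `|f y - mean mu B f|%:E)).

Definition integrable_on B : Prop :=
  [/\ measurable (B : set T), 0 < mu B, mu B < +oo &
      m.-integrable (B : set T) (EFin \o f)].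

Lemma oscE B : integrable_on B ->
  average mu B (fun y => `|f y - mean mu B f|%:E) = (osc B)%:E.
Proof.
move=> [mB B0 Boo fB]; rewrite /osc fineK//.
rewrite averageE// fin_numM//; apply: integrable_fin_num => //.
have intc := integrable_cst_fin mB Boo.
under eq_fun do rewrite -abse_EFin EFinB.
by apply: integrable_abse; exact: integrableB.
Qed.

Lemma osc_ge0 B : (0 <= osc B)%R.
Proof. by rewrite fine_ge0// average_ge0// => y _; rewrite lee_fin. Qed.

Lemma mul_oscE B : integrable_on B ->
  mu B * (osc B)%:E = \int[m]_(y in B) `|f y - mean mu B f|%:E.
Proof. by move=> iB; rewrite -oscE//; case: iB => *; rewrite mul_average. Qed.

Lemma mean_oscillationE t x : integrable_on (ball x t) ->
  mean_oscillation mu t f x = (osc (ball x t))%:E.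
Proof.
move=> iB; rewrite -oscE//; case: iB => mB B0 Boo fB.
by rewrite /mean_oscillation meanE.
Qed.

Section subset.
Variables (A B : set X) (K : R).
Hypotheses (iA : integrable_on A) (iB : integrable_on B) (AB : A `<=` B).
Hypothesis BKA : mu B <= K%:E * mu A.

Lemma average_dist_subset c :
  average mu A (fun y => `|f y - c|%:E) <= K%:E * average mu B (fun y => `|f y - c|%:E).
Proof.
move: iA iB => [mA A0 Aoo fA] [mB B0 Boo fB].
apply: average_le_subset => //; first exact: measurable_dist fB _.
Qed.

Lemma dist_mean_subset : (`|mean mu A f - mean mu B f| <= K * osc B)%R.
Proof.
move: iA => [mA A0 Aoo fA].
rewrite -lee_fin EFinM -oscE//.
exact: le_trans (dist_mean_le mA A0 Aoo fA _) (average_dist_subset _).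
Qed.

(** Replacing the mean over [A] by the mean over [B] at most doubles the average
deviation on [A]. *)
Lemma osc_subset : (osc A <= 2 * K * osc B)%R.
Proof.
move: (iA) (iB) => [mA A0 Aoo fA] [mB B0 Boo fB].
set c := mean mu B f.
have h1 : average mu A (fun y => `|f y - c|%:E) <= (K * osc B)%:E.
  by rewrite EFinM -oscE//; exact: average_dist_subset.
have h2 : (osc A)%:E <= average mu A (fun y => `|f y - c|%:E) + `|mean mu A f - c|%:E.
  rewrite -oscE// -[in X in _ <= _ + X](average_cst mA A0 Aoo `|mean mu A f - c|%:E).
  rewrite -averageD//; last exact: measurable_dist fA _.
  apply: le_average => y _; first by rewrite lee_fin.
  rewrite -EFinD lee_fin.
  by rewrite -[X in (X <= _)%R]normrN opprB distrC
       (_ : f y - mean mu A f = (f y - c) - (mean mu A f - c))%R ?ler_normB//; ring.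
rewrite -lee_fin; apply: le_trans h2 _.
rewrite (_ : (2 * K * osc B = K * osc B + K * osc B)%R); last by ring.
by rewrite EFinD leeD// lee_fin dist_mean_subset.
Qed.

End subset.
End oscillation.

(** * Separated nets and their cells *)

Section metric_balls.
Context {R : realType} {X : completeMetricType R}.
Implicit Types (x y z : X).

Lemma open_ball x (r : R) : open (ball x r).
Proof.
rewrite openE => y; rewrite ballEmdist/= => xy.
rewrite /interior; apply/nbhs_ballP; exists (r - mdist x y) => /=.
  by rewrite subr_gt0.
by move=> z; rewrite !ballEmdist/= ltrBrDl; apply: le_lt_trans; exact: metric_triangle.
Qed.

Lemma ball_subset x y (r s : R) d : ball x d y -> d + r <= s -> ball y r `<=` ball x s.
Proof. by move=> xy drs z yz; apply: le_ball drs _ _; exact: ball_triangle yz. Qed.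

End metric_balls.

Section borel_regular.
Context {R : realType} {X : completeMetricType R}.
Variable mu : {outer_measure set X -> \bar R}.
Hypothesis hreg : borel_regular mu.
Local Notation T := (caratheodory_type mu).

Lemma open_caratheodory (A : set X) : open A -> measurable (A : set T).
Proof. by move=> oA; apply: hreg.1; apply: sub_sigma_algebra. Qed.

Lemma closed_caratheodory (A : set X) : closed A -> measurable (A : set T).
Proof.
move=> cA; rewrite -(setCK A); apply: measurableC.
by apply: open_caratheodory; exact: closed_openC.
Qed.

End borel_regular.

Section cells.
Context {R : realType} {X : completeMetricType R}.

(** Points are sorted into cells by an index function, and every sum runs over
all of [nat]: an index that carries no cell may have an empty core, so that it
contributes nothing, while a nonempty cell has a ball as its core. Disjointness of
the cores is what is left of the separation of the net. *)
Record is_cells (r : R) (z : nat -> X) (idx : X -> nat) (core : nat -> set X) := {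
  cell_near : forall x, ball (z (idx x)) (2 * r) x ;
  cell_borel : forall i, borel_set (idx @^-1` [set i]) ;
  core_open : forall i, open (core i) ;
  core_subset : forall i, core i `<=` ball (z i) (r / 2) ;
  core_trivIset : trivIset setT core ;
  core_ball : forall x, core (idx x) = ball (z (idx x)) (r / 2) }.

Lemma separable_dense_seq : separable_space X ->
  exists q : nat -> X, forall x (r : R), 0 < r -> exists n, mdist (q n) x < r.
Proof.
move=> [D [/countable_injP[f finj] Dd]].
pose q n := xget point [set x | D x /\ f x = n].
exists q => x r r0.
have [y [xy Dy]] := Dd (ball x r)
  (ex_intro _ x (ballxx x r0)) (open_ball x r).
exists (f y); suff -> : q (f y) = y by move: xy; rewrite metric_sym ballEmdist.
rewrite /q; case: xgetP => [w _ [Dw fw]|/(_ y)]; last by case.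
by apply: finj => //; rewrite inE.
Qed.

Section greedy_net.
Variables (q : nat -> X) (r : R).
Hypothesis r0 : 0 < r.
Hypothesis qd : forall x (e : R), 0 < e -> exists n, mdist (q n) x < e.

(** The indices below [n], in decreasing order, of the points kept when [q] is
traversed once and a point is kept if it is [r]-far from all those kept before. *)
Fixpoint greedy n : seq nat :=
  if n is k.+1 then
    if all (fun j => r <= mdist (q j) (q k)) (greedy k) then k :: greedy k
    else greedy k
  else [::].

Definition selected n := n \in greedy n.+1.

Let greedy_lt n j : j \in greedy n -> (j < n)%N.
Proof.
elim: n => //= n ih; case: ifP => _.
  by rewrite inE => /predU1P[->//|/ih/ltnW].
by move=> /ih/ltnW.
Qed.

Let selectedE n : selected n = all (fun j => r <= mdist (q j) (q n)) (greedy n).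
Proof.
rewrite /selected/=; case: ifP => [_|_]; first by rewrite mem_head.
by apply/negP => /greedy_lt; rewrite ltnn.
Qed.

Let mem_greedy n j : (j \in greedy n) = (j < n)%N && selected j.
Proof.
elim: n => //= n ih.
have [->|jn] := eqVneq j n.
  rewrite ltnSn selectedE; case: ifP => [_|_]; first by rewrite mem_head.
  by apply/negP => /greedy_lt; rewrite ltnn.
rewrite ltnS leq_eqVlt (negbTE jn)/= -ih; case: ifP => // _.
by rewrite inE (negbTE jn).
Qed.

Let selected_dist j n : (j < n)%N -> selected j -> selected n ->
  r <= mdist (q j) (q n).
Proof.
move=> jn sj; rewrite selectedE => /allP/(_ j); apply.
by rewrite mem_greedy jn.
Qed.

Let selected_close n : exists2 j, selected j & mdist (q j) (q n) < r.
Proof.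
have [sn|] := boolP (selected n); first by exists n => //; rewrite mdistxx.
rewrite selectedE => /allPn[j]; rewrite mem_greedy -ltNge => /andP[_ sj] jn.
by exists j.
Qed.

Let near_net x : exists j, selected j && (mdist (q j) x < 2 * r).
Proof.
have [n qn] := qd x r0; have [j sj jn] := selected_close n.
exists j; rewrite sj/=; apply: le_lt_trans (metric_triangle _ (q n) _) _; lra.
Qed.

(* Taking the least admissible index makes the cells Borel: each is a ball minus
finitely many balls. *)
Let idx x := ex_minn (near_net x).

Let core i := if selected i then ball (q i) (r / 2) else set0.

Let catch i := if selected i then ball (q i) (2 * r) else set0.

Let idxE i : idx @^-1` [set i] = catch i `\` \bigcup_(j in `I_i) catch j.
Proof.
rewrite /catch; apply/seteqP; split=> x /=; rewrite /idx; case: ex_minnP.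
  move=> j /andP[sj qj] jmin ij; rewrite -ij sj ballEmdist/=; split => //.
  move=> [k /= kj]; case: ifPn => // sk; rewrite ballEmdist/= => qk.
  by have := jmin k; rewrite sk qk/= leqNgt kj => /(_ isT).
move=> j /andP[sj qj] jmin; case: ifPn => [si|_ []//].
rewrite ballEmdist/= => -[qi nx].
apply/eqP; rewrite eqn_leq jmin ?si ?qi//= leqNgt; apply/negP => ji.
by apply: nx; exists j => //; rewrite sj ballEmdist.
Qed.

Lemma greedy_cells : exists z idx core, is_cells r z idx core.
Proof.
exists q, idx, core; split.
- by move=> x; rewrite ballEmdist/= /idx; case: ex_minnP => j /andP[].
- move=> i; rewrite idxE.
  pose B := g_sigma_algebraType (@open X).
  have mcatch j : measurable (catch j : set B).
    apply: sub_sigma_algebra; rewrite /catch; case: ifP => _; first exact: open_ball.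
    exact: open0.
  have : measurable (catch i `\` \bigcup_(j in `I_i) catch j : set B).
    by apply: measurableD => //; apply: bigcup_measurable => j _.
  by [].
- by move=> i; rewrite /core; case: ifP => _; [exact: open_ball|exact: open0].
- by move=> i x; rewrite /core; case: ifP.
- have sep i j : (i < j)%N -> core i `&` core j = set0.
    move=> ij; rewrite /core; case: ifPn => si; last by rewrite set0I.
    case: ifPn => sj; last by rewrite setI0.
    rewrite -subset0 => x []; rewrite !ballEmdist/= => ix jx.
    have := selected_dist ij si sj.
    have := metric_triangle (q i) x (q j); rewrite (metric_sym x); lra.
  apply/trivIsetP => i j _ _; case: (ltngtP i j) => // ij _; first exact: sep.
  by rewrite setIC sep.
- move=> x; rewrite /core /idx; case: ex_minnP => j /andP[sj _] _.
  by rewrite sj.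
Qed.

End greedy_net.

Lemma exists_cells : separable_space X -> forall r : R, 0 < r ->
  exists z idx core, is_cells r z idx core.
Proof. by move=> /separable_dense_seq[q qd] r r0; exact: greedy_cells qd. Qed.

End cells.

(** * Dyadic scales and doubling *)

Section doubling.
Context {R : realType} {X : completeMetricType R}.
Variable mu : {outer_measure set X -> \bar R}.
Implicit Types (K : R).
Local Open Scope ereal_scope.

(** All comparisons of balls at one or two consecutive scales involve radii with
ratio at most 64, so this single constant serves everywhere. *)
Definition doubling64 K : Prop := forall x y (r s : R), (0 < r <= 1)%R ->
  ball y s `<=` ball x (64 * r)%R -> mu (ball y s) <= K%:E * mu (ball x r).

(** Doubling iterated six times, from radius at most 1 to radius at most 64;
the last doubled radius is at most 32. *)
Lemma exists_doubling64 : uniformly_locally_doubling mu ->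
  exists2 K, (0 < K)%R & doubling64 K.
Proof.
move=> /(_ 32%R (ltr0Sn _ _))[C C0 dC]; exists (C ^+ 6)%R; first exact: exprn_gt0.
move=> x y r s /andP[r0 r1] /(@le_outer_measure _ _ mu)/le_trans; apply.
have it n : (n <= 6)%N -> mu (ball x (2 ^+ n * r)%R) <= (C ^+ n)%:E * mu (ball x r).
  elim: n => [|n ih] n6; first by rewrite !expr0 mul1r mul1e.
  rewrite !exprS -mulrA; apply: le_trans (dC _ _ _) _.
    have n5 : (2 ^+ n <= 2 ^+ 5 :> R)%R by rewrite ler_weXn2l// ler1n.
    have : (0 < 2 ^+ n :> R)%R by rewrite exprn_gt0.
    by move: n5; rewrite (_ : 2 ^+ 5 = 32 :> R)%R; [nra|rewrite -natrX].
  rewrite EFinM -muleA lee_wpmul2l ?ih//; last exact: ltnW.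
  by rewrite lee_fin ltW.
by have := it 6%N isT; rewrite (_ : 2 ^+ 6 = 64 :> R)%R// -natrX.
Qed.

End doubling.

Section scales.
Context {R : realType}.

(** The offset 4 gives [16 * scale j = 2^-j], so the radii from [12 * scale j] to
[16 * scale j] used to recover the Besov seminorm lie below 1. *)
Definition scale (j : nat) : R := (2^-1) ^+ (j + 4).

Lemma scale_gt0 j : 0 < scale j. Proof. by rewrite exprn_gt0// invr_gt0. Qed.

Lemma scaleS j : scale j.+1 = scale j / 2.
Proof. by rewrite /scale addSn exprSr. Qed.

Lemma scale_le j : 16 * scale j <= 1.
Proof.
rewrite /scale exprD (_ : 2^-1 ^+ 4 = 16^-1 :> R); last by rewrite exprVn -natrX.
rewrite mulrCA mulfV// mulr1; apply: exprn_ile1; lra.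
Qed.

Lemma exists_scale (r : R) : 0 < r -> exists j0, scale j0 < r.
Proof.
move=> r0; have : (2^-1 ^+ n : R) @[n --> \oo] --> 0.
  by apply: cvg_expr; rewrite ger0_norm; lra.
move=> /cvgrPdist_lt/(_ r r0)[N _ /(_ N (leqnn N))/=].
rewrite sub0r normrN ger0_norm ?exprn_ge0 ?invr_ge0// => rN; exists N.
apply: le_lt_trans rN; rewrite /scale exprD ler_piMr ?exprn_ge0 ?invr_ge0//.
by apply: exprn_ile1; lra.
Qed.

(** The bound from below on the index turns smallness of the radius into
convergence along the scales. *)
Lemma scale_sandwich (r : R) n : 0 < r -> r <= scale n ->
  exists2 j, (n <= j)%N & scale j.+1 < r <= scale j.
Proof.
move=> r0 rn; have [j0 j0r] := exists_scale r0.
have ex : exists j, scale j < r by exists j0.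
have := ex_minnP ex; case=> m mr mmin.
have nm : (n < m)%N.
  rewrite ltnNge; apply/negP => mn.
  have : scale n <= scale m.
    by rewrite /scale ler_wiXn2l ?leq_add2r//; lra.
  by move=> /le_lt_trans/(_ mr); rewrite ltNge rn.
case: m nm mr mmin => // m nm mr mmin; exists m => //.
by rewrite mr leNgt; apply/negP => /mmin; rewrite ltnn.
Qed.

End scales.

(** * Step functions adapted to the cells *)

Section multiscale.
Context {R : realType} {X : completeMetricType R}.
Variable mu : {outer_measure set X -> \bar R}.
Hypothesis hX : metric_measure_space mu.
Variables (K : R) (dK : doubling64 mu K).
Variables (z : nat -> nat -> X) (idx : nat -> X -> nat) (core : nat -> nat -> set X).
Hypothesis cells : forall j, is_cells (scale j) (z j) (idx j) (core j).
Local Notation m := (cmeasure mu).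
Local Notation T := (caratheodory_type mu).
Local Notation r := (@scale R).

Lemma ball_measurable x (s : R) : measurable (ball x s : set T).
Proof. by apply: open_caratheodory; [case: hX|exact: open_ball]. Qed.

Lemma ball_mu_gt0 x (s : R) : 0 < s -> (0 < mu (ball x s))%E.
Proof. by case: hX => _ _ /[apply]/(_ x)/andP[]. Qed.

Lemma ball_mu_fin x (s : R) : 0 < s -> (mu (ball x s) < +oo)%E.
Proof. by case: hX => _ _ /[apply]/(_ x)/andP[]. Qed.

Lemma doubling64_ge1 : 1 <= K.
Proof.
have := @dK point point 1 1; rewrite mulr1 ltr01 lexx => /(_ isT).
have := ball_mu_gt0 point ltr01; have := ball_mu_fin point ltr01.
case: (mu (ball _ 1)) => [v| |]// _; rewrite lte_fin => v0 H.
have := H (@le_ball _ _ point 1 64 (ler1n _ 64)).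
by rewrite -EFinM lee_fin -ler_pdivrMr// divff// gt_eqF.
Qed.

Let K0 : 0 < K. Proof. exact: lt_le_trans doubling64_ge1. Qed.

Lemma core_measurable j i : measurable (core j i : set T).
Proof. by apply: open_caratheodory; [case: hX|exact: core_open (cells j) i]. Qed.

Lemma cell_measurable j i : measurable (idx j @^-1` [set i] : set T).
Proof. by case: hX => _ hreg _; apply: hreg.1; exact: cell_borel (cells j) i. Qed.

Lemma mu_cell_le j i : (mu (idx j @^-1` [set i]) <= K%:E * mu (core j i))%E.
Proof.
have [->|] := eqVneq (idx j @^-1` [set i]) set0.
  by rewrite outer_measure0 mule_ge0 ?outer_measure_ge0// lee_fin ltW.
move=> /set0P[x /= xi].
have r0 := scale_gt0 j : 0 < r j; have r16 := scale_le j : 16 * r j <= 1.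
have := core_ball (cells j) x; rewrite xi => ->.
apply: le_trans (dK (y := z j i) (s := 2 * r j) _ _).
- by apply: le_outer_measure => y /= yi; rewrite -yi; exact: (cell_near (cells j)).
- by apply/andP; split; lra.
- by apply: le_ball; lra.
Qed.

(** Additivity of the measure on disjoint cores. The indices satisfying [P]
need not be enumerated since the others contribute the empty set. *)
Lemma sum_core_le j (P : set nat) (A : set X) : (forall i, P i -> core j i `<=` A) ->
  (\sum_(i <oo) mu (if `[< P i >] then core j i else set0) <= mu A)%E.
Proof.
move=> PA; pose c i := if `[< P i >] then core j i else set0.
have mc i : measurable (c i : set T).
  by rewrite /c; case: ifP => // _; exact: core_measurable.
have tc : trivIset setT c.
  apply/trivIsetP => i k _ _ ik; rewrite /c; case: ifP => // _; last by rewrite set0I.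
  case: ifP => _; last by rewrite setI0.
  by have /trivIsetP := core_trivIset (cells j); exact.
have -> : (\sum_(i <oo) mu (c i) = mu (\bigcup_i c i))%E.
  by rewrite (@measure_bigcup _ _ _ m)//; apply: eq_eseriesl => i; rewrite in_setT.
apply: le_outer_measure => x [i _]; rewrite /c; case: asboolP => // Pi.
exact: PA.
Qed.

(** The disjoint cores of the balls of radius [3 * scale j] that contain [y] all
lie in [ball y (4 * scale j)], whose measure is comparable to that of each of these
balls. The weights also make an index with empty core contribute nothing. *)
Lemma overlap_le j y : (\sum_(i <oo)
   mu (core j i) / mu (ball (z j i) (3 * r j)) * (\1_(ball (z j i) (3 * r j)) y)%:E
   <= K%:E)%E.
Proof.
have r0 := scale_gt0 j : 0 < r j; have r16 := scale_le j : 16 * r j <= 1.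
pose c i := if `[< ball (z j i) (3 * r j) y >] then core j i else set0.
have csum : (\sum_(i <oo) mu (c i) <= mu (ball y (4 * r j)))%E.
  apply: sum_core_le => i yi x cx.
  by apply: (ball_subset (ball_sym yi) _ (core_subset (cells j) cx)); lra.
have [v v0 vE] : exists2 v, 0 < v & mu (ball y (4 * r j)) = v%:E.
  by apply: measure_EFin; [apply: ball_mu_gt0; lra|apply: ball_mu_fin; lra].
apply: (@le_trans _ _ (\sum_(i <oo) (K / v)%:E * mu (c i))%E).
  apply: lee_nneseries => i _.
    by rewrite !mule_ge0 ?outer_measure_ge0 ?inve_ge0 ?outer_measure_ge0// lee_fin.
  rewrite indicE /c; case: asboolP => yi; last first.
    by rewrite memNset// mule0 mule_ge0 ?outer_measure_ge0// lee_fin divr_ge0 ?ltW.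
  rewrite mem_set// mule1 muleC lee_wpmul2r ?outer_measure_ge0//.
  have [u u0 uE] : exists2 u, 0 < u & mu (ball (z j i) (3 * r j)) = u%:E.
    by apply: measure_EFin; [apply: ball_mu_gt0; lra|apply: ball_mu_fin; lra].
  have : (mu (ball y (4 * r j)) <= K%:E * mu (ball (z j i) (3 * r j)))%E.
    by apply: dK; [apply/andP; split; lra|apply: (ball_subset yi); lra].
  rewrite uE vE inver gt_eqF// -EFinM !lee_fin => vKu.
  by rewrite ler_pdivlMr// mulrC ler_pdivrMr.
rewrite nneseriesZl//.
apply: (@le_trans _ _ ((K / v)%:E * mu (ball y (4 * r j)))%E).
  by rewrite lee_wpmul2l// lee_fin divr_ge0// ltW.
by rewrite vE -EFinM lee_fin divfK// gt_eqF.
Qed.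

End multiscale.

Section multiscale_function.
Context {R : realType} {X : completeMetricType R}.
Variable mu : {outer_measure set X -> \bar R}.
Hypothesis hX : metric_measure_space mu.
Variables (K : R) (dK : doubling64 mu K).
Variables (z : nat -> nat -> X) (idx : nat -> X -> nat) (core : nat -> nat -> set X).
Hypothesis cells : forall j, is_cells (scale j) (z j) (idx j) (core j).
Local Notation m := (cmeasure mu).
Local Notation T := (caratheodory_type mu).
Local Notation r := (@scale R).
Variable f : X -> R.
Hypothesis fint : forall x (s : R), 0 < s ->
  m.-integrable (ball x s : set T) (EFin \o f).

Let K0 : 0 < K. Proof. exact: lt_le_trans (doubling64_ge1 hX dK). Qed.

Lemma integrable_on_ball x (s : R) : 0 < s -> integrable_on mu f (ball x s).
Proof.
move=> s0; split; [exact: ball_measurable|exact: ball_mu_gt0|exact: ball_mu_fin|].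
exact: fint.
Qed.

(** The factor 8 makes the balls nested from one scale to the next: a centre at
scale [j.+1] whose cell meets [ball (z j i) (3 * r j)] is within [4 * r j] of [z j i],
and its own ball has radius [8 * r j.+1 = 4 * r j]. *)
Definition bigball j i := ball (z j i) (8 * r j).
Definition coef j i := mean mu (bigball j i) f.
Definition dev j i := osc mu f (bigball j i).
Definition cell_mean j x := coef j (idx j x).
Definition cell_dev j x := dev j (idx j x).

Lemma integrable_on_bigball j i : integrable_on mu f (bigball j i).
Proof. by apply: integrable_on_ball; rewrite mulr_gt0// scale_gt0. Qed.

Lemma dev_ge0 j i : 0 <= dev j i. Proof. exact: osc_ge0. Qed.

(** Allowing [y] to leave the cell, up to distance [3 * r j] of its centre, covers
the balls of radius at most [r j] centred in the cell. *)
Lemma dist_cell_meanS_coef j i y : ball (z j i) (3 * r j) y ->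
  `|cell_mean j.+1 y - coef j i| <= K * dev j i.
Proof.
move=> yi; have r0 := scale_gt0 j : 0 < r j; have r16 := scale_le j : 16 * r j <= 1.
have rS := @scaleS R j.
have yn := cell_near (cells j.+1) y.
apply: dist_mean_subset; [exact: integrable_on_bigball|exact: integrable_on_bigball| |].
- have ziz : ball (z j i) (3 * r j + 2 * r j.+1) (z j.+1 (idx j.+1 y)).
    exact: ball_triangle yi (ball_sym yn).
  by apply: (ball_subset ziz); rewrite rS; lra.
- apply: dK; first by apply/andP; split; rewrite rS; lra.
  have ziz : ball (z j.+1 (idx j.+1 y)) (2 * r j.+1 + 3 * r j) (z j i).
    exact: ball_triangle yn (ball_sym yi).
  by apply: (ball_subset ziz); rewrite rS; lra.
Qed.

Lemma dist_cell_meanS j x : `|cell_mean j.+1 x - cell_mean j x| <= K * cell_dev j x.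
Proof.
apply: dist_cell_meanS_coef; apply: le_ball (cell_near (cells j) x).
by have := scale_gt0 j : 0 < r j; lra.
Qed.

Lemma dist_cell_mean_sum j n x :
  `|cell_mean (j + n) x - cell_mean j x| <= \sum_(k < n) K * cell_dev (j + k)%N x.
Proof.
elim: n => [|n ih]; first by rewrite addn0 subrr normr0 big_ord0.
rewrite big_ord_recr/= addnS.
have -> : cell_mean (j + n).+1 x - cell_mean j x =
  (cell_mean (j + n) x - cell_mean j x) + (cell_mean (j + n).+1 x - cell_mean (j + n) x) by ring.
by apply: (le_trans (ler_normD _ _)); apply: lerD => //; exact: dist_cell_meanS.
Qed.

(** [ball y t] contains the ball carrying [dev j i] because
[r j / 2 + 8 * r j <= 12 * r j]. *)
Lemma dev_le_osc j i y t : core j i y -> 12 * r j <= t -> t <= 16 * r j ->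
  dev j i <= 2 * K * osc mu f (ball y t).
Proof.
move=> cy t12 t16; have r0 := scale_gt0 j : 0 < r j; have r16 := scale_le j : 16 * r j <= 1.
have yi := core_subset (cells j) cy.
apply: osc_subset.
- exact: integrable_on_bigball.
- by apply: integrable_on_ball; lra.
- by apply: (ball_subset (ball_sym yi)); lra.
- by apply: dK; [apply/andP; split; lra|apply: (ball_subset yi); lra].
Qed.

Definition coreball j i := ball (z j i) (r j / 2).
(** Disjointness of the cores makes the sum of the integrals of [`|f| `^ p] over
them at most its integral over X; the means over the overlapping [bigball]s
would cost an overlap constant. *)
Definition core_coef j i := mean mu (coreball j i) f.

Lemma integrable_on_coreball j i : integrable_on mu f (coreball j i).
Proof. by apply: integrable_on_ball; rewrite divr_gt0// scale_gt0. Qed.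

Lemma dist_core_coef j i : `|core_coef j i - coef j i| <= K * dev j i.
Proof.
have r0 := scale_gt0 j : 0 < r j; have r16 := scale_le j : 16 * r j <= 1.
apply: dist_mean_subset;
  [exact: integrable_on_coreball|exact: integrable_on_bigball| |].
- by apply: le_ball; lra.
- by apply: dK; [apply/andP; split; lra|apply: le_ball; lra].
Qed.

Lemma measurable_cell_fun (nu : {outer_measure set X -> \bar R}) d' (U : measurableType d')
    (c : nat -> U) (D : set X) j : borel_regular nu ->
  measurable_fun (D : set (caratheodory_type nu)) (fun x => c (idx j x)).
Proof.
move=> hnu; apply: (@measurable_fun_fibers _ _ (caratheodory_type nu)) => i.
by apply: hnu.1; exact: (cell_borel (cells j)).
Qed.

Local Open Scope ereal_scope.

Definition dev_energy (p : R) j : \bar R :=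
  \sum_(i <oo) (dev j i `^ p)%:E * mu (core j i).

Lemma dev_energy_ge0 p j : 0 <= dev_energy p j.
Proof.
by apply: nneseries_ge0 => i _ _; rewrite mule_ge0 ?outer_measure_ge0// lee_fin powR_ge0.
Qed.

Lemma integral_cell_dev_powR_le (nu : {outer_measure set X -> \bar R}) (E : set X) (kappa p : R) j :
  borel_regular nu -> measurable (E : set (caratheodory_type nu)) -> (0 <= kappa)%R ->
  (forall i, nu (idx j @^-1` [set i] `&` E) <= kappa%:E * mu (core j i)) ->
  \int[cmeasure nu]_(x in E) (cell_dev j x `^ p)%:E <= kappa%:E * dev_energy p j.
Proof.
move=> hnu mE k0 nuk.
have -> : \int[cmeasure nu]_(x in E) (cell_dev j x `^ p)%:E =
   \sum_(i <oo) (dev j i `^ p)%:E * nu (idx j @^-1` [set i] `&` E).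
  apply: (@integral_fibers _ _ _ (cmeasure nu) E (idx j) (fun i => (dev j i `^ p)%:E)) => //.
  - by move=> i; apply: hnu.1; exact: (cell_borel (cells j)).
  - by move=> i; rewrite lee_fin powR_ge0.
rewrite /dev_energy -nneseriesZl//; last first.
  by move=> i _; rewrite mule_ge0 ?outer_measure_ge0// lee_fin powR_ge0.
apply: lee_nneseries => i _.
  by rewrite mule_ge0 ?outer_measure_ge0// lee_fin powR_ge0.
by rewrite muleCA lee_wpmul2l ?lee_fin ?powR_ge0.
Qed.

(** The step function equal to [dev j i] on the disjoint cores lies below the
oscillation over balls of radius [t], up to the factor [2 * K]. *)
Lemma dev_energy_le_oscillation (p t : R) j : (1 <= p)%R ->
  (12 * r j <= t)%R -> (t <= 16 * r j)%R ->
  dev_energy p j <= ((2 * K) `^ p)%:E * \int[m]_x ((osc mu f (ball x t)) `^ p)%:E.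
Proof.
move=> p1 t12 t16; have p0 : (0 < p)%R by rewrite (lt_le_trans _ p1).
have K20 : (0 < (2 * K) `^ p)%R by rewrite powR_gt0// mulr_gt0.
rewrite -lee_pdivrMl//.
pose c i := (((2 * K) `^ p)^-1 * dev j i `^ p)%R.
have c0 i : (0 <= c i)%R by rewrite mulr_ge0 ?invr_ge0 ?powR_ge0.
have mc i := core_measurable hX cells j i.
have -> : (((2 * K) `^ p)^-1)%:E * dev_energy p j =
   \int[m]_x \sum_(i <oo) (c i)%:E * (\1_(core j i) x)%:E.
  rewrite (@integral_nneseries_indic _ _ _ m)//.
  rewrite /dev_energy -nneseriesZl; last first.
    by move=> i _; rewrite mule_ge0 ?outer_measure_ge0// lee_fin powR_ge0.
  by apply: eq_eseriesr => i _; rewrite setIT muleA.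
apply: ge0_le_integral_lower => x _.
  by apply: nneseries_ge0 => i _ _; rewrite mule_ge0 ?lee_fin.
apply: nneseries_indic_disjoint_le => //.
- exact: core_trivIset (cells j).
- by rewrite lee_fin powR_ge0.
move=> i xi; rewrite lee_fin /c ler_pdivrMl// -powRM; last exact: osc_ge0.
  by apply: ge0_ler_powR_le; [exact: ltW|exact: dev_ge0|exact: dev_le_osc].
by rewrite mulr_ge0// ltW.
Qed.

End multiscale_function.

(** * Discretisation of the Besov seminorm *)

Section besov_discrete.
Context {R : realType} {X : completeMetricType R}.
Variable mu : {outer_measure set X -> \bar R}.
Hypothesis hX : metric_measure_space mu.
Variables (K : R) (dK : doubling64 mu K).
Variables (z : nat -> nat -> X) (idx : nat -> X -> nat) (core : nat -> nat -> set X).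
Hypothesis cells : forall j, is_cells (scale j) (z j) (idx j) (core j).
Local Notation m := (cmeasure mu).
Local Notation T := (caratheodory_type mu).
Local Notation r := (@scale R).
Variable f : X -> R.
Hypothesis fint : forall x (s : R), 0 < s ->
  m.-integrable (ball x s : set T) (EFin \o f).
Variables (p s : R).
Hypotheses (p1 : 1 <= p) (s0 : 0 < s).
Local Open Scope ereal_scope.

Let K0 : (0 < K)%R. Proof. exact: lt_le_trans (doubling64_ge1 hX dK). Qed.
Let p0 : (0 < p)%R. Proof. exact: lt_le_trans p1. Qed.
Let pn0 : (p != 0)%R. Proof. by rewrite gt_eqF. Qed.

Definition energy_root j : \bar R := dev_energy mu z core f p j `^ p^-1.

Lemma energy_root_ge0 j : 0 <= energy_root j. Proof. exact: poweR_ge0. Qed.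

Lemma energy_root_le_Lnorm j t : (12 * r j <= t)%R -> (t <= 16 * r j)%R ->
  energy_root j <= (2 * K)%:E * 'N[m]_p%:E[mean_oscillation mu t f].
Proof.
move=> t12 t16; have t0 : (0 < t)%R by have := scale_gt0 j : (0 < r j)%R; lra.
have := dev_energy_le_oscillation hX dK cells fint p1 t12 t16.
have -> : \int[m]_x (osc mu f (ball x t) `^ p)%:E =
    'N[m]_p%:E[mean_oscillation mu t f] `^ p.
  rewrite (poweR_Lnorm m _ pn0); apply: eq_integral => x _.
  rewrite mean_oscillationE; last exact: integrable_on_ball.
  by rewrite abse_EFin ger0_norm ?osc_ge0.
rewrite -poweR_EFin -poweRM ?lee_fin ?mulr_ge0 ?(ltW K0) ?Lnorm_ge0//.
set N := _ * _ => h.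
have N0 : 0 <= N by rewrite mule_ge0 ?Lnorm_ge0// lee_fin mulr_ge0// ltW.
have -> : N = (N `^ p) `^ p^-1 by rewrite -poweRrM mulfV// poweRe1.
by apply: le_poweR => //; [rewrite invr_ge0 ltW|exact: dev_energy_ge0].
Qed.

(* These intervals are disjoint since [16 * r j.+1 = 8 * r j]. *)
Let I j : set R := [set` `[(12 * r j)%R, (16 * r j)%R[ ].

Let trivI : trivIset setT I.
Proof.
have sep i j : (i < j)%N -> I i `&` I j = set0.
  move=> ij; rewrite -subset0 => t []; rewrite /I/= !in_itv/= => /andP[ti _] /andP[_ tj].
  have : (r j <= r i.+1)%R by rewrite /scale ler_wiXn2l ?leq_add2r//; lra.
  by rewrite scaleS; have := scale_gt0 i : (0 < r i)%R; lra.
apply/trivIsetP => i j _ _; case: (ltngtP i j) => // ij _; first exact: sep.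
by rewrite setIC sep.
Qed.

Lemma scale16 j : (16 * r j = 2^-1 ^+ j)%R.
Proof.
rewrite /scale exprD (_ : 2^-1 ^+ 4 = 16^-1 :> R)%R; last by rewrite exprVn -natrX.
by rewrite mulrCA mulfV// mulr1.
Qed.

Lemma powR_scale16 j u : ((16 * r j) `^ (- u) = (2 `^ u) ^+ j)%R.
Proof.
rewrite scale16 -[in LHS]powR_mulrn ?invr_ge0// -powR_inv1// -!powRrM.
by rewrite -powR_mulrn ?powR_ge0// -powRrM; congr powR; ring.
Qed.

(** On [I j], of length [2^-j / 4], the weight [t `^ (- s) / t] is at least
[2 `^ (s * j) * 2 ^ j]. The integrand therefore dominates the step function with
values [c j], in which the length of [I j] is compensated by [2 ^ j]. *)
Lemma sum_energy_root_le :
  \sum_(j <oo) ((2 `^ s) ^+ j)%:E * energy_root j <=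
  (8 * K)%:E * besov_seminorm mu s p f.
Proof.
have K8 : (0 < 8 * K)%R by rewrite mulr_gt0.
rewrite -lee_pdivrMl//.
pose c j : \bar R := ((2 `^ s) ^+ j * (2 ^+ j) / (2 * K))%:E * energy_root j.
have c0 j : 0 <= c j.
  by rewrite mule_ge0 ?energy_root_ge0// lee_fin divr_ge0 ?mulr_ge0 ?exprn_ge0 ?powR_ge0 ?(ltW K0).
have mI j : measurable (I j) by exact: measurable_itv.
have -> : ((8 * K)^-1)%:E * (\sum_(j <oo) ((2 `^ s) ^+ j)%:E * energy_root j) =
   \int[lebesgue_measure]_(t in `]0%R, 1%R[) \sum_(j <oo) c j * (\1_(I j) t)%:E.
  rewrite integral_nneseries_indic// -nneseriesZl; last first.
    by move=> i _; rewrite mule_ge0 ?energy_root_ge0// lee_fin exprn_ge0 ?powR_ge0.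
  apply: eq_eseriesr => j _; rewrite setIidl; last first.
    move=> t; rewrite /I/= !in_itv/=.
    have := scale_gt0 j : (0 < r j)%R; have := scale_le j : (16 * r j <= 1)%R.
    by move=> ? ? /andP[? ?]; apply/andP; split; lra.
  have r0 := scale_gt0 j : (0 < r j)%R.
  have volI : lebesgue_measure (I j) = (4^-1 * (16 * r j))%:E.
    rewrite lebesgue_measure_itv/= lte_fin ifT; last by lra.
    by rewrite -EFinB; congr EFin; field.
  rewrite [X in _ = c j * X]volI /c muleAC muleA -!EFinM.
  congr (_%:E * _); rewrite scale16 exprVn.
  by field; rewrite ?expf_neq0 ?gt_eqF.
apply: ge0_le_integral_lower => t t01.
  by apply: nneseries_ge0 => i _ _; rewrite mule_ge0 ?lee_fin.
have {t01} /andP[t0 t1] : (0 < t < 1)%R by move: t01; rewrite /= in_itv.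
apply: nneseries_indic_disjoint_le => //.
  by rewrite !mule_ge0 ?Lnorm_ge0 ?lee_fin ?powR_ge0 ?invr_ge0 ?(ltW t0).
move=> j; rewrite /I/= in_itv/= => /andP[t12 /ltW t16].
have := energy_root_le_Lnorm t12 t16.
rewrite -lee_pdivrMl ?mulr_gt0// => eN.
rewrite muleAC -EFinM /c.
have -> : ((2 `^ s) ^+ j * 2 ^+ j / (2 * K))%:E * energy_root j =
    ((2 `^ s) ^+ j * 2 ^+ j)%:E * ((2 * K)^-1%:E * energy_root j).
  by rewrite muleA -EFinM.
apply: lee_pmul => //.
  by rewrite mule_ge0 ?energy_root_ge0// lee_fin invr_ge0 mulr_ge0// ltW.
have tj u : (0 < u)%R -> ((2 `^ u) ^+ j <= t `^ (- u))%R.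
  move=> u0; rewrite -powR_scale16 !powRN lef_pV2 ?posrE ?powR_gt0//; last first.
    by rewrite mulr_gt0// scale_gt0.
  by apply: ge0_ler_powR_le => //; exact: ltW.
rewrite lee_fin; apply: ler_pM; rewrite ?exprn_ge0 ?powR_ge0//.
  exact: tj.
by have := tj 1%R ltr01; rewrite powRr1// powR_inv1// ltW.
Qed.

(** The finite seminorm makes every energy finite, and real numbers replace
extended ones from here on. *)
Lemma exists_energy_sequence : besov_seminorm mu s p f < +oo ->
  exists a : R^nat, [/\ (forall j, 0 <= a j)%R,
    (forall j, dev_energy mu z core f p j = (a j `^ p)%:E) &
    (forall n, \sum_(j < n) (2 `^ s) ^+ j * a j <= 8 * K * fine (besov_seminorm mu s p f))%R].
Proof.
move=> fin.
have sn0 : 0 <= besov_seminorm mu s p f.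
  apply: integral_ge0 => t; rewrite /= in_itv/= => /andP[t0 _].
  by rewrite !mule_ge0 ?Lnorm_ge0 ?lee_fin ?powR_ge0 ?invr_ge0 ?(ltW t0).
have := sum_energy_root_le; rewrite -[X in _ * X]fineK ?ge0_fin_numE// -EFinM => bnd.
have term0 j : 0 <= ((2 `^ s) ^+ j)%:E * energy_root j.
  by rewrite mule_ge0 ?energy_root_ge0// lee_fin exprn_ge0// powR_ge0.
have part n := le_trans (nneseries_lim_ge n (fun j _ _ => term0 j)) bnd.
have fine_root j : energy_root j = (fine (energy_root j))%:E.
  rewrite fineK// ge0_fin_numE ?energy_root_ge0//.
  have : ((2 `^ s) ^+ j)%:E * energy_root j < +oo.
    apply: le_lt_trans (ltry (8 * K * fine (besov_seminorm mu s p f))%R).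
    apply: le_trans (part j.+1); rewrite big_nat_recr//= leeDr//.
    by apply: sume_ge0 => i _.
  have : (0 < (2 `^ s) ^+ j)%R by rewrite exprn_gt0// powR_gt0.
  by case: (energy_root j) => // [v _ _|]; rewrite ?ltry// => h; rewrite gt0_muley.
exists (fun j => fine (energy_root j)); split.
- by move=> j; rewrite fine_ge0// energy_root_ge0.
- move=> j; rewrite -poweR_EFin -fine_root /energy_root -poweRrM mulVf// poweRe1//.
  exact: dev_energy_ge0.
- move=> n; rewrite -lee_fin; apply: le_trans (part n).
  rewrite -sumEFin big_mkord; apply: lee_sum => j _.
  by rewrite EFinM -fine_root.
Qed.

End besov_discrete.

(** * Convergence of the cell means almost everywhere *)

Lemma nneseries_EFin_le {R : realType} (u : R^nat) (W : R) : (forall k, 0 <= u k) ->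
  (forall n, \sum_(k < n) u k <= W) -> (\sum_(k <oo) (u k)%:E <= W%:E)%E.
Proof.
move=> u0 uW; apply: lime_le.
  by apply: is_cvg_nneseries => k _ _; rewrite lee_fin.
by apply: nearW => n; rewrite sumEFin lee_fin big_mkord.
Qed.

Section convergence_mu.
Context {R : realType} {X : completeMetricType R}.
Variable mu : {outer_measure set X -> \bar R}.
Hypothesis hX : metric_measure_space mu.
Variables (K : R) (dK : doubling64 mu K).
Variables (z : nat -> nat -> X) (idx : nat -> X -> nat) (core : nat -> nat -> set X).
Hypothesis cells : forall j, is_cells (scale j) (z j) (idx j) (core j).
Local Notation m := (cmeasure mu).
Local Notation T := (caratheodory_type mu).
Local Notation r := (@scale R).
Variable f : X -> R.
Hypothesis mf : measurable_fun [set: T] f.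
Hypothesis fint : forall x (s : R), 0 < s ->
  m.-integrable (ball x s : set T) (EFin \o f).
Variables (p t M : R) (alpha : R^nat).
Hypotheses (p1 : 1 <= p) (t1 : 1 < t) (alpha0 : forall j, 0 <= alpha j).
Hypothesis energy : forall j, dev_energy mu z core f p j = (alpha j `^ p)%:E.
Hypothesis alphaM : forall n, \sum_(j < n) t ^+ j * alpha j <= M.

Let K0 : 0 < K. Proof. exact: lt_le_trans (doubling64_ge1 hX dK). Qed.
Let p0 : 0 < p. Proof. exact: lt_le_trans p1. Qed.
Let tk0 k : 0 < t ^+ k. Proof. by rewrite exprn_gt0// (lt_trans _ t1). Qed.
Local Notation S := (cell_mean mu z idx f).

Lemma weighted_bound_ge0 : 0 <= M. Proof. by have := alphaM 0; rewrite big_ord0. Qed.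

Lemma alpha_le k : alpha k <= M * (t ^+ k)^-1.
Proof.
rewrite ler_pdivlMr// mulrC; apply: le_trans (alphaM k.+1).
by rewrite big_ord_recr/= lerDr sumr_ge0// => i _; rewrite mulr_ge0// ltW.
Qed.

Lemma measurable_dist_cell_mean (D : set X) k : measurable_fun (D : set T)
  (fun y => `|f y - S k y|%:E).
Proof.
apply/measurable_EFinP; apply: measurableT_comp => //; apply: measurable_funB.
  exact: measurable_funS mf.
by apply: (measurable_cell_fun cells); case: hX.
Qed.

(** On each cell the integral is at most [K * mu core * dev]. The threshold
[l = t ^- k] trades [dev] for [dev `^ p]: the first part is paid by the cores near the
ball, of finite total measure, the second by the energy, which is at most
[(M * l) `^ p]. *)
Lemma integral_dist_cell_mean_le x0 (n : R) k : 0 < n ->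
  (\int[m]_(y in ball x0 n) `|f y - S k y|%:E <=
   (K * (fine (mu (ball x0 (n + 1))) + M `^ p) * (t ^+ k)^-1)%:E)%E.
Proof.
move=> n0; set B := ball x0 n; pose F i := idx k @^-1` [set i] `&` B.
have r0 := scale_gt0 k : 0 < r k; have r16 := scale_le k : 16 * r k <= 1.
have mB : measurable (B : set T) by exact: ball_measurable.
have mF i : measurable (F i : set T).
  by apply: measurableI => //; exact: (cell_measurable hX cells).
have BE : B = \bigcup_i F i.
  by rewrite /F -setI_bigcupl; apply/seteqP; split=> y //=; [split => //; exists (idx k y)|case].
have tF : trivIset setT F.
  apply/trivIsetP => i j _ _ /eqP ij; rewrite -subset0 => y [[/= yi _] [/= yj _]].
  by apply: ij; rewrite -yi.
rewrite BE ge0_integral_bigcup//; last first.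
  exact: measurable_dist_cell_mean.
pose l : R := (t ^+ k)^-1.
have l0 : 0 < l by rewrite invr_gt0.
pose c i := if `[< F i !=set0 >] then core k i else set0.
pose V := fine (mu (ball x0 (n + 1))).
have VE : mu (ball x0 (n + 1)) = V%:E.
  rewrite fineK// ge0_fin_numE ?outer_measure_ge0//; apply: ball_mu_fin => //; lra.
have csum : (\sum_(i <oo) mu (c i) <= V%:E)%E.
  rewrite -VE; apply: (sum_core_le hX cells) => i [y [/= yi By]] x cx.
  have yz := cell_near (cells k) y; rewrite yi in yz.
  have zz := ball_triangle By (ball_sym yz).
  by apply: (ball_subset zz _ (core_subset (cells k) cx)); lra.
have term i : (\int[m]_(y in F i) `|f y - S k y|%:E <=
    (K * l)%:E * mu (c i) + (K * l `^ (1 - p))%:E * ((dev mu z f k i `^ p)%:E * mu (core k i)))%E.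
  have d0 := dev_ge0 mu z f k i.
  have rhs0 : (0 <= (K * l `^ (1 - p))%:E * ((dev mu z f k i `^ p)%:E * mu (core k i)))%E.
    by rewrite !mule_ge0 ?outer_measure_ge0 ?lee_fin ?powR_ge0// mulr_ge0 ?powR_ge0// ltW.
  rewrite /c; case: asboolP => [[y [/= yi By]]|Fi]; last first.
    have -> : F i = set0 by apply/eqP/negPn; apply/negP => /set0P.
    by rewrite integral_set0 outer_measure0 mule0 add0e.
  have coreE := core_ball (cells k) y; rewrite yi in coreE.
  apply: (@le_trans _ _ (K%:E * mu (core k i) * (dev mu z f k i)%:E)%E).
    have iB := integrable_on_bigball hX z fint k i.
    apply: (@le_trans _ _ (\int[m]_(y in bigball z k i) `|f y - coef mu z f k i|%:E)%E).
      have -> : (\int[m]_(y in F i) `|f y - S k y|%:E = \int[m]_(y in F i) `|f y - coef mu z f k i|%:E)%E.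
        by apply: eq_integral => w; rewrite inE /= /cell_mean => -[/= -> _].
      apply: (@ge0_subset_integral _ _ _ m) => //.
      - by case: iB.
      - by apply: measurable_dist; case: iB.
      - move=> w [/= wi _]; have := cell_near (cells k) w; rewrite wi; apply: le_ball; lra.
    rewrite -mul_oscE// -/(dev mu z f k i) lee_wpmul2r ?lee_fin// coreE.
    by apply: dK; [apply/andP; split; lra|apply: le_ball; lra].
  have [v v0 vE] : exists2 v, 0 <= v & mu (core k i) = v%:E.
    exists (fine (mu (core k i))); first by rewrite fine_ge0 ?outer_measure_ge0.
    by rewrite fineK// coreE ge0_fin_numE ?outer_measure_ge0// ball_mu_fin// divr_gt0.
  rewrite vE -!EFinM -EFinD lee_fin.
  have := le_threshold_powR p1 l0 d0.
  have -> : K * l * v + K * l `^ (1 - p) * (dev mu z f k i `^ p * v) =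
    K * v * (l + l `^ (1 - p) * dev mu z f k i `^ p) by ring.
  by move=> thr; rewrite ler_wpM2l// mulr_ge0// ltW.
apply: (@le_trans _ _ (\sum_(i <oo) ((K * l)%:E * mu (c i) +
    (K * l `^ (1 - p))%:E * ((dev mu z f k i `^ p)%:E * mu (core k i))))%E).
  by apply: lee_nneseries => i _ // _; apply: integral_ge0 => w _; rewrite lee_fin.
have Kl0 : 0 <= K * l by rewrite mulr_ge0// ltW.
have Klp0 : 0 <= K * l `^ (1 - p) by rewrite mulr_ge0 ?powR_ge0// ltW.
have term0 i : (0 <= (dev mu z f k i `^ p)%:E * mu (core k i))%E.
  by rewrite mule_ge0 ?outer_measure_ge0// lee_fin powR_ge0.
rewrite nneseriesD; last 2 first.
- by move=> i _ _; rewrite mule_ge0 ?outer_measure_ge0// lee_fin.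
- by move=> i _ _; rewrite mule_ge0// lee_fin.
rewrite !nneseriesZl//.
rewrite -/(dev_energy mu z core f p k) energy.
apply: (@le_trans _ _ ((K * l)%:E * V%:E + (K * l `^ (1 - p))%:E * (M `^ p * l `^ p)%:E)%E).
  apply: leeD; first by rewrite lee_wpmul2l ?lee_fin.
  rewrite lee_wpmul2l ?lee_fin// -powRM ?weighted_bound_ge0//; last exact: ltW.
  by apply: ge0_ler_powR_le => //; [exact: ltW|exact: alpha_le].
rewrite -!EFinM -EFinD lee_fin le_eqVlt; apply/orP; left; apply/eqP.
have -> : K * l `^ (1 - p) * (M `^ p * l `^ p) = K * M `^ p * (l `^ (1 - p) * l `^ p) by ring.
rewrite -powRD; last by rewrite (gt_eqF l0) implybT.
by rewrite subrK powRr1 ?ltW//; rewrite -/l -/V; ring.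
Qed.

Lemma geometric_sum_le n : \sum_(k < n) (t ^+ k)^-1 <= (1 - t^-1)^-1.
Proof.
have t0 : 0 < t by rewrite (lt_trans _ t1).
have tV : 0 < 1 - t^-1 by rewrite subr_gt0 invf_lt1.
rewrite -[leRHS]mul1r ler_pdivlMr//.
under eq_bigr do rewrite -exprVn.
have := subrX1 t^-1 n => h.
have -> : (\sum_(k < n) t^-1 ^+ k) * (1 - t^-1) = 1 - t^-1 ^+ n.
  by rewrite -[in RHS]opprB h mulrC -mulNr opprB.
by rewrite gerBl exprn_ge0// invr_ge0 ltW.
Qed.

(** Geometric decay of the integrals over a ball makes them summable. This
replaces the Lebesgue differentiation theorem. *)
Lemma ae_cell_mean_cvg : {ae m, forall y : X, S k y @[k --> \oo] --> f y}.
Proof.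
have local (n : nat) : {ae m, forall y : X, ball point n.+1%:R y ->
    `|f y - S k y|%:E @[k --> \oo] --> 0%E}.
  apply: ae_cvg0_summable_integral.
  - exact: ball_measurable.
  - by move=> k; exact: measurable_dist_cell_mean.
  - by move=> k x _; rewrite lee_fin.
  set C := K * (fine (mu (ball (point : X) (n.+1%:R + 1))) + M `^ p).
  have C0 : 0 <= C.
    by rewrite mulr_ge0 ?addr_ge0 ?powR_ge0 ?fine_ge0 ?outer_measure_ge0// ltW.
  apply: (@le_lt_trans _ _ (C * (1 - t^-1)^-1)%:E); last exact: ltry.
  apply: (@le_trans _ _ (\sum_(k <oo) (C * (t ^+ k)^-1)%:E)%E).
    apply: lee_nneseries => k _; first by move=> _; apply: integral_ge0 => y _; rewrite lee_fin.
    exact: integral_dist_cell_mean_le.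
  apply: nneseries_EFin_le => [k|N]; first by rewrite mulr_ge0 ?invr_ge0// ltW.
  by rewrite -mulr_sumr ler_wpM2l// geometric_sum_le.
have := ae_foralln local.
apply: filterS => y yP.
have [n yn] : exists n : nat, ball (point : X) n.+1%:R y.
  exists (Num.truncn (mdist (point : X) y)); rewrite ballEmdist/=.
  by rewrite truncnS_gt.
have := yP n yn; move/fine_cvgP => -[_ h].
apply/cvgrPdist_lt => e e0; move/cvgrPdist_lt : h => /(_ e e0).
apply: filterS => k; rewrite sub0r normrN /=.
by rewrite normr_id.
Qed.

End convergence_mu.

(** * Convergence of the cell means on the trace set *)

Section bounded_variation.
Context {R : realType}.
Variables (u d : R^nat) (M : R).
Hypothesis du : forall k, `|u k.+1 - u k| <= d k.
Hypothesis dM : forall n, \sum_(k < n) d k <= M.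

Let d0 k : 0 <= d k. Proof. exact: le_trans (du k). Qed.

Lemma bounded_sum_cvg : cvgn (series d).
Proof.
apply: nondecreasing_is_cvgn.
  by apply/nondecreasing_seqP => n; rewrite seriesSr lerDl.
by exists M => _ [n _ <-]; rewrite /series/= big_mkord.
Qed.

Lemma bounded_sum_cvg0 : d n @[n --> \oo] --> 0.
Proof. exact: cvg_series_cvg_0 bounded_sum_cvg. Qed.

Lemma bounded_variation_cvg : cvgn u.
Proof.
have cs : cvgn (series (fun k => u k.+1 - u k)).
  apply: normed_cvg; apply: series_le_cvg bounded_sum_cvg => // k; exact: normr_ge0.
have -> : u = (fun n => u 0 + series (fun k => u k.+1 - u k) n).
  by apply/funext => n; rewrite /series/= telescope_sumr// addrC subrK.
by apply: is_cvgD => //; exact: is_cvg_cst.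
Qed.

End bounded_variation.

Lemma ge0_cvge0P {R : realType} {U : Type} (F : set_system U) {FF : Filter F}
    (g : U -> \bar R) : (forall x, 0 <= g x)%E ->
  (forall e : R, 0 < e -> \forall x \near F, (g x <= e%:E)%E) <->
  g x @[x --> F] --> 0%E.
Proof.
move=> g0; split=> [gF|].
  have gfin : \forall x \near F, g x \is a fin_num.
    apply: filterS (gF 1 ltr01) => x gx.
    by rewrite ge0_fin_numE// (le_lt_trans gx)// ltry.
  apply/fine_cvgP; split => //; apply/cvgrPdist_le => e e0.
  apply: filterS2 gfin (gF e e0) => x xfin gx.
  by rewrite sub0r normrN /= ger0_norm ?fine_ge0// -lee_fin fineK.
move=> /fine_cvgP[gfin /cvgrPdist_le gF] e e0.
apply: filterS2 gfin (gF e e0) => x xfin.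
by rewrite sub0r normrN /= ger0_norm ?fine_ge0// -lee_fin fineK.
Qed.

(* One carrier type bears a sigma-algebra for each outer measure; stating these
filter facts for a measure lets the measurable structure be given explicitly. *)
Section ae_lemmas.
Context d (T : measurableType d) (R : realType) (mu : {measure set T -> \bar R}).

Lemma ae_sub (P Q : T -> Prop) : (forall x, P x -> Q x) ->
  {ae mu, forall x, P x} -> {ae mu, forall x, Q x}.
Proof. by move=> PQ; apply: filterS. Qed.

Lemma ae_sub2 (P Q W : T -> Prop) : (forall x, P x -> Q x -> W x) ->
  {ae mu, forall x, P x} -> {ae mu, forall x, Q x} -> {ae mu, forall x, W x}.
Proof. by move=> PQW; apply: filterS2. Qed.

End ae_lemmas.

Section trace_measure.
Context {R : realType} {X : completeMetricType R}.
Variable mu : {outer_measure set X -> \bar R}.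
Hypothesis hX : metric_measure_space mu.
Variables (K : R) (dK : doubling64 mu K).
Variables (z : nat -> nat -> X) (idx : nat -> X -> nat) (core : nat -> nat -> set X).
Hypothesis cells : forall j, is_cells (scale j) (z j) (idx j) (core j).
Local Notation m := (cmeasure mu).
Local Notation T := (caratheodory_type mu).
Local Notation r := (@scale R).
Variable f : X -> R.
Hypothesis mf : measurable_fun [set: T] f.
Hypothesis fint : forall x (s : R), 0 < s ->
  m.-integrable (ball x s : set T) (EFin \o f).
Variables (p t M : R) (alpha : R^nat).
Hypotheses (p1 : 1 <= p) (t1 : 1 < t) (alpha0 : forall j, 0 <= alpha j).
Hypothesis energy : forall j, dev_energy mu z core f p j = (alpha j `^ p)%:E.
Hypothesis alphaM : forall n, \sum_(j < n) t ^+ j * alpha j <= M.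
Variables (nu : {outer_measure set X -> \bar R}) (E : set X) (kap : R).
Hypotheses (hnu : borel_regular nu).
Hypothesis mE : measurable (E : set (caratheodory_type nu)).
Hypothesis kap0 : 0 <= kap.
Hypothesis codim : forall j i, (nu (idx j @^-1` [set i] `&` E) <=
  (kap * (t ^+ j) `^ p)%:E * mu (core j i))%E.
Local Notation n_ := (cmeasure nu).

Let K0 : 0 < K. Proof. exact: lt_le_trans (doubling64_ge1 hX dK). Qed.
Let p0 : 0 < p. Proof. exact: lt_le_trans p1. Qed.
Let pn0 : p != 0. Proof. by rewrite gt_eqF. Qed.
Let tk0 k : 0 < t ^+ k. Proof. by rewrite exprn_gt0// (lt_trans _ t1). Qed.
Local Notation S := (cell_mean mu z idx f).
Local Notation G := (cell_dev mu z idx f).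

Let KG k x := K * G k x.
Let KG0 k x : 0 <= KG k x.
Proof. by rewrite mulr_ge0 ?(ltW K0)//; exact: dev_ge0. Qed.

(** One estimate for both measures: [nu] on [E], where [c] grows like [t ^+ j], and
[mu] on the whole space, where [c] is constant. *)
Let integral_KG_le (la : {outer_measure set X -> \bar R}) (D : set X) (c : R) j :
  borel_regular la -> measurable (D : set (caratheodory_type la)) -> 0 <= c ->
  (forall i, la (idx j @^-1` [set i] `&` D) <= (c `^ p)%:E * mu (core j i))%E ->
  (\int[cmeasure la]_(x in D) (KG j x `^ p)%:E <= ((K * c * alpha j) `^ p)%:E)%E.
Proof.
move=> hla mD c0 lac.
rewrite (_ : (fun _ => _) = (fun x => (K `^ p)%:E * (G j x `^ p)%:E)%E); last first.
  by apply/funext => x; rewrite -EFinM -powRM//; [exact: ltW|exact: dev_ge0].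
rewrite ge0_integralZl//; last 3 first.
- apply/measurable_EFinP; apply: (measurableT_comp (measurable_powR p)).
  exact: (measurable_cell_fun cells).
- by move=> x _; rewrite lee_fin powR_ge0.
- by rewrite lee_fin powR_ge0.
rewrite -mulrA powRM ?mulr_ge0//; last exact: ltW.
rewrite EFinM lee_wpmul2l ?lee_fin ?powR_ge0// powRM// EFinM -energy.
by apply: (integral_cell_dev_powR_le cells) => //; exact: powR_ge0.
Qed.

Lemma integral_KG_nu j :
  (\int[n_]_(x in E) (KG j x `^ p)%:E <=
   ((K * kap `^ p^-1 * (t ^+ j * alpha j)) `^ p)%:E)%E.
Proof.
rewrite mulrA -(mulrA K); apply: integral_KG_le => //.
  by rewrite mulr_ge0 ?powR_ge0// ltW.
by move=> i; rewrite powRM ?powR_ge0 ?(ltW (tk0 j))// powRVK.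
Qed.

Lemma integral_KG_mu j :
  (\int[m]_x (KG j x `^ p)%:E <= ((K * K `^ p^-1 * alpha j) `^ p)%:E)%E.
Proof.
apply: integral_KG_le => //; first by case: hX.
  exact: powR_ge0.
by move=> i; rewrite setIT powRVK ?(ltW K0)//; exact: (mu_cell_le hX dK cells).
Qed.

Let mKG (la : {outer_measure set X -> \bar R}) (D : set X) k : borel_regular la ->
  measurable_fun (D : set (caratheodory_type la)) (KG k).
Proof. exact: (measurable_cell_fun cells (fun i => K * dev mu z f k i)). Qed.

Lemma ae_bounded_variation :
  {ae n_, forall x : X, E x -> exists M', forall n, \sum_(k < n) KG k x <= M'}.
Proof.
apply: (ae_bounded_sums mE p1 _ _ _ integral_KG_nu (W := K * kap `^ p^-1 * M)).
- by move=> k; exact: mKG.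
- by move=> k x _.
- by move=> k; rewrite !mulr_ge0 ?powR_ge0// ?(ltW K0)// ltW.
- by move=> n; rewrite -mulr_sumr ler_wpM2l ?mulr_ge0 ?powR_ge0 ?(ltW K0).
Qed.

(** A bound for [`|f - S j.+1| `^ p], see [ae_dist_le_tail_dev]. *)
Definition tail_dev j : X -> \bar R := powR_sum_lim p (fun k => KG (j.+1 + k)).
Definition tail_average j i : \bar R := average mu (ball (z j i) (3 * r j)) (tail_dev j).

Lemma tail_dev_ge0 j y : (0 <= tail_dev j y)%E.
Proof. by apply: (powR_sum_lim_ge0 (T := T) (D := setT) p1) => // k x _. Qed.

Lemma tail_average_ge0 j i : (0 <= tail_average j i)%E.
Proof. by apply: average_ge0 => y _; exact: tail_dev_ge0. Qed.

Lemma measurable_tail_dev (D : set X) j : measurable_fun (D : set T) (tail_dev j).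
Proof.
apply: (@measurable_funS _ _ T _ setT) => //.
apply: (measurable_powR_sum_lim (T := T) (D := setT) p1) => [k|k x _] //.
by apply: mKG; case: hX.
Qed.

Lemma integral_tail_dev_le j :
  (\int[m]_y tail_dev j y <= ((K * K `^ p^-1 * tail alpha j.+1) `^ p)%:E)%E.
Proof.
have c0 : 0 <= K * K `^ p^-1 by rewrite mulr_ge0 ?powR_ge0// ltW.
apply: (minkowski_series (mu := m) (D := setT) _ p1 (w := fun k => K * K `^ p^-1 * alpha (j.+1 + k)%N)) => //.
- by move=> k; apply: mKG; case: hX.
- by move=> k; rewrite mulr_ge0.
- by move=> k; exact: integral_KG_mu.
- by move=> n; rewrite -mulr_sumr ler_wpM2l// (sum_le_tail t1 alpha0 alphaM).
Qed.

Lemma ae_dist_le_tail_dev : {ae m, forall (y : X) j,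
  ((`|f y - S j.+1 y| `^ p)%:E <= tail_dev j y)%E}.
Proof.
have := ae_cell_mean_cvg hX dK cells mf fint p1 t1 alpha0 energy alphaM.
apply: (@ae_sub _ T _ m) => y yP j.
have ul : S (j.+1 + n) y @[n --> \oo] --> f y.
  have := yP; rewrite -(cvg_shiftn j.+1 (fun n => S n y)).
  by under eq_fun do rewrite addnC.
apply: (powR_dist_lim_le (T := T) (D := setT) p1 _ _ _ ul) => // n.
exact: (dist_cell_mean_sum hX dK cells fint).
Qed.

(** The codimension bound turns the integral into the sum over [i] of
[mu (core j i) / mu (B i) * \int_(B i) tail_dev j] where [B i] is the ball of radius
[3 * r j], and bounded overlap compares this sum with the integral of
[tail_dev j] over X. *)
Lemma integral_tail_average_le j :
  (\int[n_]_(x in E) tail_average j (idx j x) <=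
   (kap * K * (K * K `^ p^-1) `^ p * (t ^+ j * tail alpha j.+1) `^ p)%:E)%E.
Proof.
have r0 := scale_gt0 j : 0 < r j.
have tail0 := tail_ge0 t1 alpha0 alphaM j.+1.
pose B i := ball (z j i) (3 * r j).
have B_gt0 i : (0 < mu (B i))%E by apply: ball_mu_gt0 => //; lra.
have B_fin i : (mu (B i) < +oo)%E by apply: ball_mu_fin => //; lra.
have mB i : measurable (B i : set T) by exact: ball_measurable.
pose q i := (mu (core j i) / mu (B i))%E.
have q0 i : (0 <= q i)%E by rewrite mule_ge0 ?inve_ge0 ?outer_measure_ge0.
have kt0 : 0 <= kap * (t ^+ j) `^ p by rewrite mulr_ge0 ?powR_ge0.
have mtd := @measurable_tail_dev setT j.
rewrite (@integral_fibers _ _ _ n_ E (idx j) (tail_average j)) //; last 2 first.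
- by move=> i; apply: hnu.1; exact: (cell_borel (cells j)).
- exact: tail_average_ge0.
apply: (@le_trans _ _ (\sum_(i <oo) (kap * (t ^+ j) `^ p)%:E *
    (q i * \int[m]_(y in B i) tail_dev j y))%E).
  apply: lee_nneseries => i _.
    by move=> _; rewrite mule_ge0 ?outer_measure_ge0// tail_average_ge0.
  apply: (@le_trans _ _ (tail_average j i * ((kap * (t ^+ j) `^ p)%:E * mu (core j i)))%E).
    by rewrite lee_wpmul2l ?tail_average_ge0//; exact: codim.
  have -> : tail_average j i = ((mu (B i))^-1 * \int[m]_(y in B i) tail_dev j y)%E by [].
  by rewrite muleCA /q -(muleA (mu (core j i))) (muleC (mu (core j i))).
rewrite nneseriesZl; last first.
  by move=> i _; rewrite mule_ge0// integral_ge0// => y _; exact: tail_dev_ge0.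
have -> : (\sum_(i <oo) q i * \int[m]_(y in B i) tail_dev j y =
   \int[m]_y \sum_(i <oo) (q i * ((\1_(B i) y)%:E * tail_dev j y)))%E.
  have mind i : measurable_fun [set: T] (fun y => (\1_(B i) y)%:E * tail_dev j y)%E.
    by apply: emeasurable_funM => //; exact/measurable_EFinP/measurable_indic.
  have ind0 i y : (0 <= (\1_(B i) y)%:E * tail_dev j y)%E.
    by rewrite mule_ge0 ?tail_dev_ge0// lee_fin.
  rewrite integral_nneseries//; last 2 first.
  - by move=> i; exact: measurable_funeM.
  - by move=> i y _; rewrite mule_ge0.
  apply: eq_eseriesr => i _; rewrite ge0_integralZl//.
  congr (q i * _)%E; rewrite [LHS]integral_mkcond; apply: eq_integral => y _.
  by rewrite epatch_indic muleC.
have -> : (kap * K * (K * K `^ p^-1) `^ p * (t ^+ j * tail alpha j.+1) `^ p) =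
  kap * (t ^+ j) `^ p * (K * (K * K `^ p^-1 * tail alpha j.+1) `^ p).
  have c0 : 0 <= K * K `^ p^-1 by rewrite mulr_ge0 ?powR_ge0// ltW.
  by rewrite (powRM _ c0 tail0) (powRM _ (ltW (tk0 j)) tail0); ring.
rewrite [leRHS]EFinM lee_wpmul2l ?lee_fin// EFinM.
apply: (@le_trans _ _ (K%:E * \int[m]_y tail_dev j y)%E); last first.
  by rewrite lee_wpmul2l ?lee_fin ?(ltW K0)// integral_tail_dev_le.
rewrite -ge0_integralZl//; last 2 first.
- by move=> y _; exact: tail_dev_ge0.
- by rewrite lee_fin ltW.
apply: ge0_le_integral_lower => y _.
  by apply: nneseries_ge0 => i _ _; rewrite mule_ge0// mule_ge0 ?tail_dev_ge0// lee_fin.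
under eq_eseriesr do rewrite muleA muleC.
have := tail_dev_ge0 j y; case: (tail_dev j y) => [Y| |]// Y0; last first.
  by rewrite gt0_muley ?leey// lte_fin.
rewrite nneseriesZl; last by move=> i _; rewrite mule_ge0 ?lee_fin.
rewrite muleC lee_wpmul2r//.
exact: (overlap_le hX dK cells).
Qed.

Lemma ae_tail_average_cvg0 :
  {ae n_, forall x : X, E x -> tail_average j (idx j x) @[j --> \oo] --> 0%E}.
Proof.
apply: ae_cvg0_summable_integral => //.
- by move=> j; exact: (measurable_cell_fun cells).
- by move=> j x _; exact: tail_average_ge0.
set c := kap * K * (K * K `^ p^-1) `^ p.
have c0 : 0 <= c by rewrite !mulr_ge0 ?powR_ge0// ltW.
have [M' tM'] := sum_weighted_tail_powR_le t1 alpha0 alphaM p1.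
apply: (@le_lt_trans _ _ (c * M')%:E); last exact: ltry.
apply: (@le_trans _ _ (\sum_(j <oo) (c * (t ^+ j * tail alpha j.+1) `^ p)%:E)%E).
  apply: lee_nneseries => j _; last exact: integral_tail_average_le.
  by move=> _; apply: integral_ge0 => x _; exact: tail_average_ge0.
apply: nneseries_EFin_le => [j|n]; first by rewrite mulr_ge0 ?powR_ge0.
by rewrite -mulr_sumr ler_wpM2l.
Qed.

(** Split [f y - l] as [(f y - S j.+1 y) + (S j.+1 y - S j x) + (S j x - l)]. The
ball lies within [3 * r j] of the centre of the cell of [x], where the middle term
is at most [KG j x]. *)
Lemma average_powR_le x (l rho : R) j : r j.+1 < rho -> rho <= r j ->
  (average mu (ball x rho) (fun y => (`|f y - l| `^ p)%:E) <=
   (3 `^ p)%:E * (K%:E * tail_average j (idx j x) +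
     ((KG j x) `^ p + `|S j x - l| `^ p)%:E))%E.
Proof.
move=> rlo rhi; have r0 := scale_gt0 j : 0 < r j; have r16 := scale_le j : 16 * r j <= 1.
have rS := @scaleS R j.
have rho0 : 0 < rho by rewrite rS in rlo; lra.
have xi := cell_near (cells j) x.
set i := idx j x in xi *.
have sub : ball x rho `<=` ball (z j i) (3 * r j) by apply: (ball_subset xi); lra.
have mB : measurable (ball x rho : set T) by exact: ball_measurable.
have B_gt0 : (0 < mu (ball x rho))%E by exact: ball_mu_gt0.
have B_fin : (mu (ball x rho) < +oo)%E by exact: ball_mu_fin.
have mtd D := @measurable_tail_dev D j.
set c := (KG j x) `^ p + `|S j x - l| `^ p.
have c0 : 0 <= c by rewrite addr_ge0 ?powR_ge0.
have h3 : (average mu (ball x rho) (tail_dev j) <= K%:E * tail_average j i)%E.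
  apply: average_le_subset => //.
  - exact: ball_measurable.
  - by apply: ball_mu_gt0 => //; lra.
  - by apply: ball_mu_fin => //; lra.
  - apply: dK; first by apply/andP; split => //; lra.
    by apply: (ball_subset (ball_sym xi)); lra.
  - by move=> y _; exact: tail_dev_ge0.
apply: (@le_trans _ _ ((3 `^ p)%:E * (average mu (ball x rho) (tail_dev j) + c%:E))%E); last first.
  by rewrite lee_wpmul2l ?lee_fin ?powR_ge0// leeD2r.
rewrite -[in X in (_ * (_ + X))%E](average_cst mB B_gt0 B_fin c%:E).
rewrite -averageD//; last by move=> y _; exact: tail_dev_ge0.
rewrite -averageZ ?powR_ge0//; last 2 first.
- by move=> y _; rewrite adde_ge0 ?tail_dev_ge0.
- exact: emeasurable_funD.
rewrite !averageE// lee_wpmul2l ?lee_fin ?invr_ge0 ?fine_ge0//.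
have mfl : measurable_fun (ball x rho : set T) (fun y => (`|f y - l| `^ p)%:E).
  apply/measurable_EFinP; apply: (measurableT_comp (measurable_powR p)).
  apply: measurableT_comp => //; apply: measurable_funB => //.
  exact: measurable_funS mf.
apply: (@ae_ge0_le_integral _ _ _ m) => //.
- by move=> y _; rewrite mule_ge0 ?adde_ge0 ?tail_dev_ge0 ?lee_fin ?powR_ge0.
- by apply: measurable_funeM; exact: emeasurable_funD.
have := ae_dist_le_tail_dev; apply: (@ae_sub _ T _ m) => y yY By.
have := yY j; have := tail_dev_ge0 j y.
case: (tail_dev j y) => [Y| |]//; last first.
  by move=> _ _; rewrite addye// gt0_muley ?leey// lte_fin powR_gt0.
rewrite !lee_fin => Y0 fY.
have S1 : `|S j.+1 y - S j x| <= KG j x.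
  exact: (dist_cell_meanS_coef hX dK cells fint (sub _ By)).
apply: (@le_trans _ _ ((`|f y - S j.+1 y| + `|S j.+1 y - S j x| + `|S j x - l|) `^ p)).
  apply: ge0_ler_powR_le => //; first exact: ltW.
  have -> : f y - l = (f y - S j.+1 y) + (S j.+1 y - S j x) + (S j x - l) by ring.
  by apply: le_trans (ler_normD _ _) _; rewrite lerD2r ler_normD.
apply: (le_trans (powR_sum3_le _ _ _ _)) => //; first exact: ltW.
rewrite ler_wpM2l ?powR_ge0// -addrA /c; apply: lerD => //.
by rewrite lerD2r; apply: ge0_ler_powR_le => //; exact: ltW.
Qed.

(** Where [KG] is summable and the tail averages vanish in the limit, all three
terms of [average_powR_le] tend to 0 along the scale that matches the radius. *)
Lemma ae_Lebesgue_powR : {ae n_, forall x : X, E x ->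
  cvgn (fun j => S j x) /\
  forall l, S j x @[j --> \oo] --> l ->
    average mu (ball x rho) (fun y => (`|f y - l| `^ p)%:E) @[rho --> 0^'+] --> 0%E}.
Proof.
have := ae_bounded_variation; have := ae_tail_average_cvg0.
apply: (@ae_sub2 _ _ _ n_) => x xtail xbv Ex; have {xbv} [M' xM] := xbv Ex.
have dS k : `|S k.+1 x - S k x| <= KG k x by exact: (dist_cell_meanS hX dK cells fint).
split; first exact: bounded_variation_cvg dS xM.
move=> l Sl.
have pow0 (u : R^nat) : (forall n, 0 <= u n) -> u n @[n --> \oo] --> 0 ->
    forall e : R, 0 < e -> \forall n \near \oo, u n `^ p <= e.
  move=> u0 /cvgrPdist_le ucv e e0.
  have := ucv (e `^ p^-1) (powR_gt0 _ e0); apply: filterS => n.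
  rewrite sub0r normrN ger0_norm// => un.
  by rewrite -[leRHS](powRVK pn0 (ltW e0)); apply: ge0_ler_powR_le => //; exact: ltW.
have hG := pow0 _ (fun k => KG0 k x) (bounded_sum_cvg0 dS xM).
have hS : forall e : R, 0 < e -> \forall n \near \oo, `|S n x - l| `^ p <= e.
  apply: pow0 => // ; apply/cvgr0Pnorm_le => e e0.
  move/cvgrPdist_le : Sl => /(_ e e0); apply: filterS => n.
  by rewrite normr_id distrC.
have hT := (ge0_cvge0P (fun j => tail_average_ge0 j (idx j x))).2 (xtail Ex).
apply: (ge0_cvge0P _).1 => [rho|e e0].
  by apply: average_ge0 => y _; rewrite lee_fin powR_ge0.
pose d := e / (3 `^ p * (K + 2)).
have c0 : 0 < 3 `^ p * (K + 2) by rewrite mulr_gt0 ?powR_gt0// addr_gt0.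
have d0 : 0 < d by rewrite divr_gt0.
have [N _ HN] : \forall j \near \oo, (tail_average j (idx j x) <= d%:E)%E /\
    (KG j x `^ p <= d /\ `|S j x - l| `^ p <= d).
  by apply: filterS2 (hT eventually_filter d d0) (filterI (hG d d0) (hS d d0)) => j.
near=> rho.
have rho0 : 0 < rho by near: rho; exact: nbhs_right_gt.
have rhoN : rho <= r N by near: rho; apply: nbhs_right_le; exact: scale_gt0.
have [j Nj /andP[rlo rhi]] := scale_sandwich rho0 rhoN.
apply: le_trans (average_powR_le x l rlo rhi) _.
have [hT' [hG' hS']] := HN j Nj.
rewrite (_ : e = 3 `^ p * (K * d + (d + d))); last first.
  have k1 : 3 `^ p != 0 by rewrite gt_eqF// powR_gt0.
  have k2 : K + 2 != 0 by rewrite gt_eqF// addr_gt0.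
  by rewrite /d; field; rewrite k1 k2.
rewrite [leRHS]EFinM lee_wpmul2l ?lee_fin ?powR_ge0// [leRHS]EFinD leeD//.
  by rewrite EFinM lee_wpmul2l// lee_fin (ltW K0).
by rewrite lee_fin lerD.
Unshelve. all: by end_near.
Qed.

Let mE_pow (h : X -> R) : measurable_fun (E : set (caratheodory_type nu)) h ->
  measurable_fun (E : set (caratheodory_type nu)) (fun x => (`|h x| `^ p)%:E).
Proof.
move=> mh; apply/measurable_EFinP; apply: (measurableT_comp (measurable_powR p)).
exact: measurableT_comp.
Qed.

(** Since the cores are disjoint, no overlap constant enters the sum of the
integrals of [`|f| `^ p]. *)
Lemma integral_core_coef_le (N : R) : 0 <= N ->
  (\int[m]_y (`|f y| `^ p)%:E <= (N `^ p)%:E)%E ->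
  (\int[n_]_(x in E) (`|core_coef mu z f 0 (idx 0 x)| `^ p)%:E <=
   ((kap `^ p^-1 * (2 * N)) `^ p)%:E)%E.
Proof.
move=> N0 fN; pose c i : R := `|core_coef mu z f 0 i| `^ p.
have c0 i : 0 <= c i by exact: powR_ge0.
have mfp D : measurable_fun (D : set T) (fun y => (`|f y| `^ p)%:E).
  apply: (@measurable_funS _ _ T _ setT) => //.
  apply/measurable_EFinP; apply: (measurableT_comp (measurable_powR p)).
  exact: measurableT_comp.
have mc i : measurable (core 0 i : set T) by exact: (core_measurable hX cells).
rewrite (@integral_fibers _ _ _ n_ E (idx 0) (fun i => (c i)%:E)) //; last first.
  by move=> i; apply: hnu.1; exact: (cell_borel (cells 0)).
apply: (@le_trans _ _ (\sum_(i <oo) (kap * 2 `^ p)%:E *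
    \int[m]_(y in core 0 i) (`|f y| `^ p)%:E)%E).
  apply: lee_nneseries => i _; first by rewrite mule_ge0 ?outer_measure_ge0 ?lee_fin.
  have [->|] := eqVneq (idx 0 @^-1` [set i]) set0.
    rewrite set0I measure0 mule0 mule_ge0 ?lee_fin ?mulr_ge0 ?powR_ge0//.
    by apply: integral_ge0 => y _; rewrite lee_fin powR_ge0.
  move=> /set0P[x /= xi].
  have coreE := core_ball (cells 0) x; rewrite xi in coreE.
  have iB := integrable_on_coreball hX z fint 0 i.
  have := mean_powR_le; have [mB B0 Boo fB] := iB.
  move=> /(_ _ _ _ _ mB B0 Boo f fB p p1) cle.
  have := codim 0 i; rewrite expr0 powR1 mulr1 => hcod.
  apply: (@le_trans _ _ ((c i)%:E * (kap%:E * mu (core 0 i)))%E).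
    by rewrite lee_wpmul2l ?lee_fin.
  rewrite coreE -[ball _ _]/(coreball z 0 i) -mul_average//.
  rewrite muleCA EFinM -muleA lee_wpmul2l ?lee_fin//.
  by rewrite [leRHS]muleCA [leRHS]muleC muleC [leRHS]muleC lee_wpmul2l ?outer_measure_ge0.
rewrite nneseriesZl; last first.
  by move=> i _; apply: integral_ge0 => y _; rewrite lee_fin powR_ge0.
rewrite -ge0_integral_bigcup//; last first.
  exact: core_trivIset (cells 0).
rewrite powRM ?powR_ge0//; last by rewrite mulr_ge0.
rewrite powRVK// powRM// mulrA [leRHS]EFinM lee_wpmul2l ?lee_fin ?mulr_ge0 ?powR_ge0//.
apply: le_trans fN.
apply: (@ge0_subset_integral _ _ _ m) => //.
exact: bigcup_measurable.
Qed.

(** The limit is at most the core mean at scale 0, plus [KG 0] for passing from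
the core mean to [S 0], plus the sum of all the [KG k]. *)
Lemma integral_trace_le (phi : X -> R) (N : R) : 0 <= N ->
  (\int[m]_y (`|f y| `^ p)%:E <= (N `^ p)%:E)%E ->
  measurable_fun (E : set (caratheodory_type nu)) phi ->
  {ae n_, forall x : X, E x -> S j x @[j --> \oo] --> phi x} ->
  (\int[n_]_(x in E) (`|phi x| `^ p)%:E <=
   ((kap `^ p^-1 * (2 * N + 2 * K * M)) `^ p)%:E)%E.
Proof.
move=> N0 fN mphi Sphi.
(* These three contributions form a single sequence, to which Minkowski's
inequality for series applies: index 0 is the core mean, index 1 the
additional copy of [KG 0]. *)
pose g k (x : X) := match k with
  | 0 => `|core_coef mu z f 0 (idx 0 x)|
  | 1 => KG 0 x
  | k'.+2 => KG k' x
  end.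
pose v k := K * kap `^ p^-1 * (t ^+ k * alpha k).
pose w k := match k with
  | 0 => kap `^ p^-1 * (2 * N)
  | 1 => v 0
  | k'.+2 => v k'
  end.
have k0 : 0 <= kap `^ p^-1 by exact: powR_ge0.
have v0 k : 0 <= v k by rewrite !mulr_ge0 ?powR_ge0// ?(ltW K0)// ltW.
have mg k : measurable_fun (E : set (caratheodory_type nu)) (g k).
  case: k => [|[|k]]; [|exact: mKG|exact: mKG].
  exact: (measurable_cell_fun cells (fun i => `|core_coef mu z f 0 i|)).
have g0 k x : E x -> 0 <= g k x by move=> _; case: k => [|[|k]] //=; exact: KG0.
have w0 k : 0 <= w k by case: k => [|[|k]] //=; rewrite !mulr_ge0.
have gw k : (\int[n_]_(x in E) (g k x `^ p)%:E <= (w k `^ p)%:E)%E.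
  by case: k => [|[|k]]; [exact: integral_core_coef_le|exact: integral_KG_nu|exact: integral_KG_nu].
have vM n : \sum_(k < n) v k <= K * kap `^ p^-1 * M.
  by rewrite -mulr_sumr ler_wpM2l// mulr_ge0// ltW.
have M0 : 0 <= M := weighted_bound_ge0 alphaM.
have wW n : \sum_(k < n) w k <= kap `^ p^-1 * (2 * N + 2 * K * M).
  have -> : kap `^ p^-1 * (2 * N + 2 * K * M) =
    kap `^ p^-1 * (2 * N) + (K * kap `^ p^-1 * M + K * kap `^ p^-1 * M) by ring.
  have KM0 : 0 <= K * kap `^ p^-1 * M by rewrite !mulr_ge0// ltW.
  have kN0 : 0 <= kap `^ p^-1 * (2 * N) by rewrite !mulr_ge0.
  case: n => [|[|n]]; first by rewrite big_ord0; lra.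
    by rewrite big_ord_recl big_ord0 addr0/=; lra.
  rewrite !big_ord_recl/= lerD2l; apply: lerD; last exact: vM.
  by have := vM 1; rewrite big_ord_recl big_ord0 addr0.
apply: le_trans (minkowski_series mE p1 mg g0 w0 gw wW).
apply: (@ae_ge0_le_integral _ _ _ n_) => //.
- exact: mE_pow.
- by move=> x Ex; exact: (powR_sum_lim_ge0 (T := caratheodory_type nu) p1 g0 Ex).
- exact: (measurable_powR_sum_lim p1 mg g0).
move: Sphi; apply: (@ae_sub _ _ _ n_) => x + Ex => /(_ Ex) Sx.
(* The shift by two matches the indexing of [g]. *)
pose u n := if n is n'.+2 then S n' x else 0.
have ucv : u n @[n --> \oo] --> phi x.
  by rewrite -(cvg_shiftn 2 u); under eq_fun do rewrite addn2.
rewrite -[phi x]subr0; apply: (powR_dist_lim_le (T := caratheodory_type nu) p1 g0 Ex _ ucv) => n.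
rewrite subr0; case: n => [|[|n]]; [by rewrite normr0 big_ord0|by rewrite normr0 sumr_ge0// => k _; exact: g0|].
rewrite !big_ord_recl/= addrA.
have h1 := dist_core_coef hX dK z fint 0 (idx 0 x).
have h2 := dist_cell_mean_sum hX dK cells fint 0 n x.
have -> : S n x = core_coef mu z f 0 (idx 0 x) +
   (coef mu z f 0 (idx 0 x) - core_coef mu z f 0 (idx 0 x)) + (S (0 + n) x - S 0 x).
  by rewrite add0n /cell_mean; ring.
apply: (le_trans (ler_normD _ _)); apply: lerD => //.
apply: (le_trans (ler_normD _ _)); apply: lerD => //.
by rewrite distrC.
Qed.

End trace_measure.

(** * General properties of traces *)

Section traces.
Context {R : realType} {X : completeMetricType R}.
Variables (mu nu : {outer_measure set X -> \bar R}) (E : set X).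
Hypothesis hX : metric_measure_space mu.
Local Notation m := (cmeasure mu).
Local Notation T := (caratheodory_type mu).
Local Open Scope ereal_scope.

Lemma L1loc_integrable f x (s : R) : L1loc mu f -> (0 < s)%R ->
  m.-integrable (ball x s : set T) (EFin \o f).
Proof. by move=> [_]; apply. Qed.

Lemma measurable_dist_ball f x (s c : R) : L1loc mu f -> (0 < s)%R ->
  measurable_fun (ball x s : set T) (fun y => `|f y - c|%:E).
Proof. by move=> lf s0; apply: measurable_dist; exact: L1loc_integrable. Qed.

(** Uniqueness of traces: both averages tend to 0 with the radius, the left side
does not depend on it. *)
Lemma average_dist_triangle f g x (s a b : R) : L1loc mu f -> L1loc mu g ->
  f = g %[ae m] -> (0 < s)%R ->
  `|a - b|%:E <= average mu (ball x s) (fun y => `|f y - a|%:E) +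
                 average mu (ball x s) (fun y => `|g y - b|%:E).
Proof.
move=> lf lg fg s0.
have mB : measurable (ball x s : set T) by exact: ball_measurable.
have B0 : 0 < mu (ball x s) by exact: ball_mu_gt0.
have Boo : mu (ball x s) < +oo by exact: ball_mu_fin.
have mfa := @measurable_dist_ball f x s a lf s0.
have mgb := @measurable_dist_ball g x s b lg s0.
rewrite -(average_cst mB B0 Boo `|a - b|%:E) -averageD//.
rewrite !averageE// lee_wpmul2l ?lee_fin ?invr_ge0 ?fine_ge0//.
apply: (@ae_ge0_le_integral _ _ _ m) => //.
- by move=> y _; rewrite adde_ge0 ?lee_fin.
- exact: emeasurable_funD.
move: fg; apply: (@ae_sub _ T _ m) => y fgy By.
have {}fgy : f y = g y by exact: fgy.
rewrite -EFinD lee_fin fgy.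
have -> : (a - b = (g y - b) - (g y - a))%R by ring.
by rewrite [leRHS]addrC; exact: ler_normB.
Qed.

Lemma trace_ae_unique f g phi psi : f = g %[ae m] ->
  is_trace mu nu E f phi -> is_trace mu nu E g psi ->
  {ae cmeasure nu, forall x : X, E x -> phi x = psi x}.
Proof.
move=> fg [lf _ fphi] [lg _ gpsi].
move: fphi gpsi; apply: (@ae_sub2 _ (caratheodory_type nu)) => x xf xg Ex.
have hs : average mu (ball x s) (fun y => `|f y - phi x|%:E) +
    average mu (ball x s) (fun y => `|g y - psi x|%:E) @[s --> 0^'+] --> 0.
  by rewrite -[X in _ --> X]adde0; apply: cvgeD; [|exact: xf|exact: xg].
apply/eqP; rewrite -subr_eq0 -normr_le0 -lee_fin.
apply: (cvge_ge _ hs); near=> s.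
by apply: average_dist_triangle => //; near: s; exact: nbhs_right_gt.
Unshelve. all: by end_near.
Qed.

Lemma trace_linear (a : R) f g phi psi :
  is_trace mu nu E f phi -> is_trace mu nu E g psi ->
  is_trace mu nu E (fun x => a * f x + g x)%R (fun x => a * phi x + psi x)%R.
Proof.
move=> [lf mphi fphi] [lg mpsi gpsi].
have lfg : L1loc mu (fun x => a * f x + g x)%R.
  split=> [|x s s0].
    by apply: measurable_funD; [apply: measurable_funM => //; case: lf|case: lg].
  have mB : measurable (ball x s : set T) by exact: ball_measurable.
  rewrite (_ : EFin \o _ = (fun y => a%:E * (EFin \o f) y + (EFin \o g) y))//.
  apply: integrableD => //; last exact: L1loc_integrable.
  by apply: integrableZl => //; exact: L1loc_integrable.
split; [exact: lfg|by apply: measurable_funD => //; exact: measurable_funM|].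
move: fphi gpsi; apply: (@ae_sub2 _ (caratheodory_type nu)) => x xf xg Ex.
have hs : `|a|%:E * average mu (ball x s) (fun y => `|f y - phi x|%:E) +
    average mu (ball x s) (fun y => `|g y - psi x|%:E) @[s --> 0^'+] --> 0.
  rewrite -[X in _ --> X]adde0; apply: cvgeD => //; last exact: xg.
  by rewrite -[X in _ --> X](mule0 `|a|%:E); apply: cvgeZl => //; exact: xf.
apply: (squeeze_cvge _ (cvg_cst 0) hs); near=> s.
have s0 : (0 < s)%R by near: s; exact: nbhs_right_gt.
have mB : measurable (ball x s : set T) by exact: ball_measurable.
have B0 : 0 < mu (ball x s) by exact: ball_mu_gt0.
have Boo : mu (ball x s) < +oo by exact: ball_mu_fin.
rewrite average_ge0/=; last by move=> y _; rewrite lee_fin.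
have mfp := @measurable_dist_ball f x s (phi x) lf s0.
have mgp := @measurable_dist_ball g x s (psi x) lg s0.
rewrite -averageZ// -averageD//; last exact: measurable_funeM.
apply: le_average => y _; first by rewrite lee_fin.
rewrite -EFinM -EFinD lee_fin -normrM.
have -> : (a * f y + g y - (a * phi x + psi x) = a * (f y - phi x) + (g y - psi x))%R by ring.
exact: ler_normD.
Unshelve. all: by end_near.
Qed.

Variable p : R.
Hypothesis p1 : (1 <= p)%R.

Let p0 : (0 < p)%R. Proof. exact: lt_le_trans p1. Qed.
Let pn0 : (p != 0)%R. Proof. by rewrite gt_eqF. Qed.

(** The threshold inequality with [l] of the order of the target accuracy stands
in for Hoelder's inequality. *)
Lemma Lebesgue_powR_cvg0 f (l : R) x : L1loc mu f ->
  average mu (ball x s) (fun y => (`|f y - l| `^ p)%:E) @[s --> 0^'+] --> 0 ->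
  average mu (ball x s) (fun y => `|f y - l|%:E) @[s --> 0^'+] --> 0.
Proof.
move=> lf; have avg0 (h : X -> R) s : (forall y, 0 <= h y)%R ->
    0 <= average mu (ball x s) (EFin \o h).
  by move=> h0; apply: average_ge0 => y _; rewrite lee_fin.
move=> /(ge0_cvge0P (fun s => avg0 _ s (fun y => powR_ge0 _ _))) hp.
apply: (ge0_cvge0P (fun s => avg0 _ s (fun y => normr_ge0 _))).1 => e e0.
pose l0 : R := (e / 2)%R.
have l00 : (0 < l0)%R by rewrite divr_gt0.
have c0 : (0 < l0 `^ (1 - p))%R by rewrite powR_gt0.
near=> s.
have s0 : (0 < s)%R by near: s; exact: nbhs_right_gt.
have mB : measurable (ball x s : set T) by exact: ball_measurable.
have B0 : 0 < mu (ball x s) by exact: ball_mu_gt0.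
have Boo : mu (ball x s) < +oo by exact: ball_mu_fin.
have fi := L1loc_integrable x lf s0.
have li : m.-integrable (ball x s : set T) (EFin \o (fun y => f y - l)%R).
  rewrite (_ : EFin \o _ = (fun y => (EFin \o f) y - l%:E))//.
  by apply: integrableB => //; exact: integrable_cst_fin.
apply: le_trans (average_threshold mB B0 Boo li p1 l00) _.
have : average mu (ball x s) (fun y => (`|f y - l| `^ p)%:E) <= (l0 / l0 `^ (1 - p))%:E.
  by near: s; apply: hp; rewrite divr_gt0.
move=> hs; apply: (@le_trans _ _ (l0%:E + (l0 `^ (1 - p))%:E * (l0 / l0 `^ (1 - p))%:E)).
  by rewrite leeD2l// lee_wpmul2l// lee_fin ltW.
rewrite -EFinM -EFinD lee_fin mulrCA divff ?gt_eqF// mulr1 /l0; lra.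
Unshelve. all: by end_near.
Qed.

Lemma integral_powR_Lp_norm (la : {outer_measure set X -> \bar R}) f :
  in_Lp la p f ->
  \int[cmeasure la]_x (`|f x| `^ p)%:E = ((fine (Lp_norm la p f)) `^ p)%:E.
Proof.
rewrite /in_Lp inE => /andP[_]; rewrite inE/= /finite_norm => ffin.
rewrite -poweR_EFin fineK; last by rewrite ge0_fin_numE ?Lnorm_ge0.
by rewrite /Lp_norm (poweR_Lnorm _ _ pn0).
Qed.

Lemma in_Lp_L1loc f : in_Lp mu p f -> L1loc mu f.
Proof.
move=> fLp; have mf : measurable_fun [set: T] f.
  by move: fLp; rewrite /in_Lp inE => /andP[]; rewrite inE.
split=> // x s s0.
have mB : measurable (ball x s : set T) by exact: ball_measurable.
have Boo : mu (ball x s) < +oo by exact: ball_mu_fin.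
have mfB : measurable_fun (ball x s : set T) f by exact: measurable_funS mf.
have mfp D : measurable_fun (D : set T) (fun y => (`|f y| `^ p)%:E).
  apply: (@measurable_funS _ _ T _ setT) => //.
  apply/measurable_EFinP; apply: (measurableT_comp (measurable_powR p)).
  exact: measurableT_comp.
apply/integrableP; split; first exact/measurable_EFinP.
apply: (@le_lt_trans _ _ (\int[m]_(y in ball x s) (1 + (`|f y| `^ p)%:E))).
  apply: ge0_le_integral_lower => y _; first exact: abse_ge0.
  rewrite /= -EFinD lee_fin.
  by have := le_threshold_powR p1 ltr01 (normr_ge0 (f y)); rewrite powR1 mul1r.
rewrite ge0_integralD//.
rewrite (_ : \int[m]_(_ in ball x s) 1 = 1 * mu (ball x s)); last exact: (integral_cst m mB).
rewrite mul1e lte_add_pinfty//.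
apply: (@le_lt_trans _ _ (\int[m]_y (`|f y| `^ p)%:E)).
  by apply: (@ge0_subset_integral _ _ _ m).
by rewrite integral_powR_Lp_norm// ltry.
Qed.

Lemma Lp_norm_on_le (phi : X -> R) (W : R) : measurable (E : set (caratheodory_type nu)) ->
  measurable_fun (E : set (caratheodory_type nu)) phi -> (0 <= W)%R ->
  \int[cmeasure nu]_(x in E) (`|phi x| `^ p)%:E <= (W `^ p)%:E ->
  in_Lp_on nu E p phi /\ Lp_norm_on nu E p phi <= W%:E.
Proof.
move=> mE mphi W0 hW.
have nW : Lp_norm_on nu E p phi <= W%:E.
  have -> : W%:E = (W%:E `^ p) `^ p^-1 by rewrite -poweRrM mulfV// poweRe1.
  have -> : Lp_norm_on nu E p phi = (Lp_norm_on nu E p phi `^ p) `^ p^-1.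
    by rewrite -poweRrM mulfV// poweRe1// Lnorm_ge0.
  apply: le_poweR; [by rewrite invr_ge0 ltW|exact: poweR_ge0|].
  rewrite /Lp_norm_on /Lp_norm (poweR_Lnorm _ _ pn0); apply: le_trans hW.
  rewrite [leRHS]integral_mkcond; apply: ge0_le_integral_lower => x _.
    exact: poweR_ge0.
  rewrite /= !patchE; case: ifPn => // _.
  by rewrite normr0 powR0.
split=> //; rewrite /in_Lp_on /in_Lp inE; apply/andP; split; rewrite inE/=.
  exact/(measurable_restrictT _ _).1.
by rewrite /finite_norm; apply: le_lt_trans nW (ltry _).
Qed.

Lemma Lp_on_ae_eq (phi psi : X -> R) : measurable (E : set (caratheodory_type nu)) ->
  measurable_fun (E : set (caratheodory_type nu)) phi ->
  measurable_fun (E : set (caratheodory_type nu)) psi ->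
  {ae cmeasure nu, forall x : X, E x -> phi x = psi x} ->
  in_Lp_on nu E p psi ->
  in_Lp_on nu E p phi /\ Lp_norm_on nu E p phi = Lp_norm_on nu E p psi.
Proof.
move=> mE mphi mpsi phipsi psiLp.
have mr (h : X -> R) : measurable_fun (E : set (caratheodory_type nu)) h ->
    measurable_fun [set: caratheodory_type nu] (h \_ E : X -> R).
  by move=> mh; exact/(measurable_restrictT _ _).1.
have mp (h : X -> R) : measurable_fun (E : set (caratheodory_type nu)) h ->
    measurable_fun [set: caratheodory_type nu] (fun x => `|((h \_ E) x)%:E| `^ p).
  move=> /mr mh.
  apply: (measurableT_comp (measurable_poweR p)).
  by apply: measurableT_comp => //; exact/measurable_EFinP.
have nE : Lp_norm_on nu E p phi = Lp_norm_on nu E p psi.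
  have back (h : X -> R) : Lp_norm_on nu E p h = (Lp_norm_on nu E p h `^ p) `^ p^-1.
    by rewrite -poweRrM mulfV// poweRe1// Lnorm_ge0.
  rewrite (back phi) (back psi) /Lp_norm_on /Lp_norm !(poweR_Lnorm _ _ pn0).
  apply: (congr1 (fun v => v `^ p^-1)); apply: (@ge0_ae_eq_integral _ (caratheodory_type nu)).
  - exact: measurableT.
  - exact: mp.
  - exact: mp.
  - by move=> x _; exact: poweR_ge0.
  - by move=> x _; exact: poweR_ge0.
  move: phipsi; apply: (@ae_sub _ (caratheodory_type nu)) => x phix _.
  by rewrite /= !patchE; case: ifPn => // /set_mem Ex; rewrite phix.
split=> //; rewrite /in_Lp_on /in_Lp inE; apply/andP; split; rewrite inE/=.
  exact: mr.
rewrite /finite_norm -/(Lp_norm_on nu E p phi).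
have : Lp_norm_on nu E p psi < +oo.
  by move: psiLp; rewrite /in_Lp_on /in_Lp inE => /andP[_]; rewrite inE.
by rewrite -nE.
Qed.

End traces.

(** * Traces of Besov functions *)

Section besov_traces.
Context {R : realType} {X : completeMetricType R}.
Variables (mu nu : {outer_measure set X -> \bar R}) (E : set X) (p theta : R).
Hypothesis hX : metric_measure_space mu.
Hypothesis hdbl : uniformly_locally_doubling mu.
Hypothesis hE : closed E.
Hypothesis hnu : borel_regular nu.
Hypothesis p1 : 1 <= p.
Hypothesis theta0 : 0 < theta.
Hypothesis hcodim : upper_codim_regular mu nu E theta.
Local Notation B := (besov mu (theta / p) p).

Let p0 : 0 < p. Proof. exact: lt_le_trans p1. Qed.
Let pn0 : p != 0. Proof. by rewrite gt_eqF. Qed.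

(** A cell that meets [E] at [e] lies in [ball e (4 * scale j)], which is comparable
to the core by doubling; the constant [4 `^ theta] converts [4 * scale j] into
[16 * scale j = 2^-j]. *)
Lemma codim_cells (K : R) (z : nat -> nat -> X) idx core : doubling64 mu K ->
  (forall j, is_cells (scale j) (z j) (idx j) (core j)) ->
  exists2 kap : R, 0 <= kap & forall j i,
    (nu (idx j @^-1` [set i] `&` E) <=
     (kap * ((2 `^ (theta / p)) ^+ j) `^ p)%:E * mu (core j i))%E.
Proof.
move=> dK cells; have [C C0 nuC] := hcodim.
have K0 : 0 < K by exact: lt_le_trans (doubling64_ge1 hX dK).
have k0 : 0 <= C * K * 4 `^ theta by rewrite !mulr_ge0 ?powR_ge0// ltW.
exists (C * K * 4 `^ theta) => // j i.
have r0 := scale_gt0 j : (0 < (scale j : R)); have r16 := scale_le j : 16 * scale j <= 1 :> R.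
have [->|] := eqVneq (idx j @^-1` [set i] `&` E) set0.
  by rewrite outer_measure0 mule_ge0 ?outer_measure_ge0// lee_fin mulr_ge0 ?powR_ge0.
move=> /set0P[e [/= ei Ee]].
have coreE := core_ball (cells j) e; rewrite ei in coreE.
have en := cell_near (cells j) e; rewrite ei in en.
have powE : ((2 `^ (theta / p)) ^+ j) `^ p = (16 * scale j) `^ (- theta).
  have powj u : (2 `^ u) ^+ j = 2 `^ (u * j%:R) :> R.
    by rewrite -powR_mulrn ?powR_ge0// -powRrM.
  by rewrite powR_scale16 !powj -powRrM; congr powR; field; rewrite pn0.
apply: (@le_trans _ _ (nu (ball e (4 * scale j) `&` E))).
  apply: le_outer_measure => y [/= yi Ey]; split => //.
  have yn := cell_near (cells j) y; rewrite yi in yn.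
  by apply: le_ball (ball_triangle (ball_sym en) yn); lra.
apply: le_trans (nuC e _ Ee _) _; first by apply/andP; split; lra.
have mK : (mu (ball e (4 * scale j)) <= K%:E * mu (core j i))%E.
  rewrite coreE; apply: dK; first by apply/andP; split; lra.
  by apply: (ball_subset en); lra.
apply: (@le_trans _ _ (C%:E * (K%:E * mu (core j i) * (((4 * scale j) `^ theta)^-1)%:E))%E).
  by rewrite lee_wpmul2l ?lee_fin ?(ltW C0)// lee_wpmul2r// lee_fin invr_ge0 powR_ge0.
rewrite [X in (_ * X)%E]muleC !muleA -!EFinM le_eqVlt; apply/orP; left; apply/eqP.
congr (_%:E * _)%E; rewrite powE powRN.
have -> : 16 * scale j = 4 * (4 * scale j) :> R by ring.
rewrite (@powRM _ 4 (4 * scale j)) ?mulr_ge0 ?(ltW r0)// invfM.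
have t4 : 4 `^ theta != 0 by rewrite gt_eqF ?powR_gt0.
have s4 : (4 * scale j) `^ theta != 0 by rewrite gt_eqF ?powR_gt0 ?mulr_gt0.
by field; rewrite t4 s4.
Qed.

(** The constant depends on the nets and on the doubling and codimension
constants only, which are therefore fixed before [f]. *)
Lemma exists_besov_trace : exists2 C : R, 0 <= C & forall f, B f ->
  exists phi, [/\ is_trace mu nu E f phi, in_Lp_on nu E p phi,
    (Lp_norm_on nu E p phi <= C%:E * besov_norm mu (theta / p) p f)%E &
    {ae cmeasure nu, forall x : X, E x ->
      average mu (ball x r) (fun y => (`|f y - phi x| `^ p)%:E) @[r --> 0^'+] --> 0%E}].
Proof.
have [K K0 dK] := exists_doubling64 hdbl.
have /choice[z /choice[idx /choice[core cells]]] : forall j, exists z idx core,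
    is_cells (scale j : R) z idx (core : nat -> set X).
  by move=> j; apply: exists_cells; [case: hX|exact: scale_gt0].
have [kap kap0 hkap] := codim_cells dK cells.
pose t : R := 2 `^ (theta / p).
have s0 : 0 < theta / p by rewrite divr_gt0.
have t1 : 1 < t.
  have : 1 `^ (theta / p) < t by apply: gt0_ltr_powR => //; rewrite ?nnegrE ?ltr1n.
  by rewrite powR1.
have mE : measurable (E : set (caratheodory_type nu)) by exact: closed_caratheodory.
pose C := kap `^ p^-1 * (2 + 16 * K * K).
have C0 : 0 <= C by rewrite mulr_ge0 ?powR_ge0// addr_ge0// !mulr_ge0// ltW.
exists C => // f [fLp fsn].
have lf := in_Lp_L1loc hX p1 fLp.
have fint x (s : R) : 0 < s -> (cmeasure mu).-integrable
  (ball x s : set (caratheodory_type mu)) (EFin \o f) by move=> s0'; exact: lf.2.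
have mf := lf.1.
have [alpha [alpha0 energy alphaM]] := exists_energy_sequence hX dK cells fint p1 s0 fsn.
set sn := fine (besov_seminorm mu (theta / p) p f) in alphaM.
set N := fine (Lp_norm mu p f).
have N0 : 0 <= N by rewrite fine_ge0 ?Lnorm_ge0.
have fN := integral_powR_Lp_norm p1 fLp; rewrite -/N in fN.
have key := ae_Lebesgue_powR hX dK cells mf fint p1 t1 alpha0 energy alphaM hnu mE kap0 hkap.
pose S j x := cell_mean mu z idx f j x.
(* The upper limit is measurable on all of [E], including where [S] diverges. *)
pose phi x := fine (limn_esup (fun j => (S j x)%:E)).
have phiE x l : S j x @[j --> \oo] --> l -> phi x = l.
  move=> Sl; rewrite /phi.
  have Sle : (S j x)%:E @[j --> \oo] --> l%:E by apply: cvg_EFin; [exact: nearW|].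
  by rewrite (cvg_limn_einf_sup Sle).2.
have mphi : measurable_fun (E : set (caratheodory_type nu)) phi.
  apply: (measurableT_comp (f := fine)); first exact: fine_measurable.
  apply: (@measurable_fun_limn_esup _ (caratheodory_type nu)) => j.
  apply/measurable_EFinP.
  exact: (measurable_cell_fun cells (fun i => coef mu z f j i)).
have Sphi : {ae cmeasure nu, forall x : X, E x -> S j x @[j --> \oo] --> phi x}.
  move: key; apply: (@ae_sub _ (caratheodory_type nu)) => x xP Ex.
  by have [cS _] := xP Ex; rewrite (phiE x _ cS).
have Leb : {ae cmeasure nu, forall x : X, E x ->
      average mu (ball x r) (fun y => (`|f y - phi x| `^ p)%:E) @[r --> 0^'+] --> 0%E}.
  move: key Sphi; apply: (@ae_sub2 _ (caratheodory_type nu)) => x xP Sx Ex.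
  by have [_] := xP Ex; apply; exact: Sx.
have fN' : (\int[cmeasure mu]_y (`|f y| `^ p)%:E <= (N `^ p)%:E)%E by rewrite fN.
have bnd := integral_trace_le hX dK cells mf fint p1 t1 alpha0 energy alphaM hnu mE kap0 hkap
  N0 fN' mphi Sphi.
have sn0 : 0 <= sn.
  rewrite fine_ge0// integral_ge0// => u; rewrite /= in_itv/= => /andP[u0 _].
  by rewrite !mule_ge0 ?Lnorm_ge0 ?lee_fin ?powR_ge0 ?invr_ge0 ?(ltW u0).
have W0 : 0 <= kap `^ p^-1 * (2 * N + 2 * K * (8 * K * sn)).
  by rewrite mulr_ge0 ?powR_ge0// addr_ge0 ?mulr_ge0// ltW.
have [phiLp phin] := Lp_norm_on_le p1 mE mphi W0 bnd.
exists phi; split; [split; [exact: lf|exact: mphi|]|exact: phiLp| |exact: Leb].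
  move: Leb; apply: (@ae_sub _ (caratheodory_type nu)) => x xP Ex.
  by apply: (Lebesgue_powR_cvg0 hX p1 lf); exact: xP.
apply: (le_trans phin).
have nE : besov_norm mu (theta / p) p f = (N + sn)%:E.
  rewrite /besov_norm EFinD /N /sn !fineK//.
    by rewrite ge0_fin_numE// integral_ge0// => u; rewrite /= in_itv/= => /andP[u0 _];
      rewrite !mule_ge0 ?Lnorm_ge0 ?lee_fin ?powR_ge0 ?invr_ge0 ?(ltW u0).
  rewrite ge0_fin_numE ?Lnorm_ge0//.
  by move: fLp; rewrite /in_Lp inE => /andP[_]; rewrite inE.
rewrite nE -EFinM lee_fin.
have -> : C * (N + sn) = kap `^ p^-1 * ((2 + 16 * K * K) * (N + sn)) by rewrite mulrA.
rewrite ler_wpM2l ?powR_ge0//.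
have -> : (2 + 16 * K * K) * (N + sn) = 2 * N + 2 * K * (8 * K * sn) + (2 * sn + 16 * K * K * N) by ring.
by rewrite lerDl addr_ge0 ?mulr_ge0// ltW.
Qed.

End besov_traces.

Theorem theorem1p2 (R : realType) (X : completeMetricType R)
  (mu nu : {outer_measure set X -> \bar R}) (E : set X) (p theta : R)
  (hX : metric_measure_space mu)
  (hdbl : uniformly_locally_doubling mu)
  (hE : closed E)
  (hnu_reg : borel_regular nu)
  (hnu_fin : locally_finite_on_balls nu)
  (hnu_supp : measure_support nu `<=` E)
  (hp : 1 <= p)
  (htheta : 0 < theta < p)
  (hcodim : upper_codim_regular mu nu E theta) :
  [/\ forall f, besov mu (theta / p) p f -> exists phi, is_trace mu nu E f phi,
      forall f phi, besov mu (theta / p) p f -> is_trace mu nu E f phi ->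
        in_Lp_on nu E p phi,
      bounded_operator_to_Lp mu nu E p (besov mu (theta / p) p)
        (besov_norm mu (theta / p) p) (is_trace mu nu E) &
      forall f phi, besov mu (theta / p) p f -> is_trace mu nu E f phi ->
        {ae cmeasure nu, forall x : X, E x ->
          average mu (ball x r) (fun y => (`|f y - phi x| `^ p)%:E)
            @[r --> 0^'+] --> 0%E}].
Proof.
have /andP[theta0 _] := htheta.
have [C C0 main] := exists_besov_trace hX hdbl hE hnu_reg hp theta0 hcodim.
have uniq f phi psi : is_trace mu nu E f phi -> is_trace mu nu E f psi ->
    {ae cmeasure nu, forall x : X, E x -> phi x = psi x}.
  move=> fphi fpsi; apply: (trace_ae_unique hX _ fphi fpsi).
  by apply: nearW.
(* The trace constructed from the cell means agrees nu-a.e. with any given one. *)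
have transfer f phi : besov mu (theta / p) p f -> is_trace mu nu E f phi ->
    exists2 psi, is_trace mu nu E f psi /\ {ae cmeasure nu, forall x : X, E x -> phi x = psi x} &
    [/\ in_Lp_on nu E p psi,
    (Lp_norm_on nu E p psi <= C%:E * besov_norm mu (theta / p) p f)%E &
    {ae cmeasure nu, forall x : X, E x ->
      average mu (ball x r) (fun y => (`|f y - psi x| `^ p)%:E) @[r --> 0^'+] --> 0%E}].
  move=> bf fphi; have [psi [fpsi h1 h2 h3]] := main f bf.
  by exists psi; split => //; exact: uniq fphi fpsi.
have mE : measurable (E : set (caratheodory_type nu)) by exact: closed_caratheodory.
have bnd f phi : besov mu (theta / p) p f -> is_trace mu nu E f phi ->
  in_Lp_on nu E p phi /\ (Lp_norm_on nu E p phi <= C%:E * besov_norm mu (theta / p) p f)%E.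
  move=> bf fphi; have [psi [fpsi phipsi] [psiLp psin _]] := transfer f phi bf fphi.
  have [_ mphi _] := fphi; have [_ mpsi _] := fpsi.
  have [h1 h2] := Lp_on_ae_eq hp mE mphi mpsi phipsi psiLp.
  by rewrite h2.
split.
- by move=> f /main[phi [fphi _ _ _]]; exists phi.
- by move=> f phi bf fphi; have [] := bnd f phi bf fphi.
- split.
  + by move=> f /main[phi [fphi _ _ _]]; exists phi.
  + by move=> f phi bf fphi; have [] := bnd f phi bf fphi.
  + by move=> f g phi psi _ _ fg fphi gpsi; exact: (trace_ae_unique hX fg fphi gpsi).
  + by move=> a f g phi psi _ _; exact: trace_linear.
  + exists C; first exact: C0.
    by move=> f phi bf fphi; have [] := bnd f phi bf fphi.
- move=> f phi bf fphi; have [psi [_ phipsi] [_ _ Leb]] := transfer f phi bf fphi.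
  move: phipsi Leb; apply: (@ae_sub2 _ (caratheodory_type nu)) => x phix Lebx Ex.
  by rewrite phix//; exact: Lebx.
Qed.
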